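(* Let $\mathscr{F}$ be the Fourier operator on the Hilbert space $L^2(\mathbb{R})$, and for $\lambda\in\{1,-1,i,-i\}$ let $\mathcal{X}_\lambda=\{x\in L^2(\mathbb{R}) : \mathscr{F}x=\lambda x\}$. Let $h_n$ ($n=0,1,2,\ldots$) be the functions defined by $h_0(t)=e^{-t^2/2}$ and $h_n=(\mathfrak{a}^{\dagger})^n h_0$, where $\mathfrak{a}^{\dagger}=-\frac{d}{dt}+t$. Then: 1. The spectrum of $\mathscr{F}$ consists of the four points $\mu=1,\ \mu=-1,\ \mu=i,\ \mu=-i$, and each of these points is an eigenvalue of infinite multiplicity. 2. The space $L^2(\mathbb{R})$ is the orthogonal sum of the corresponding eigenspaces, $$L^2(\mathbb{R})=\mathcal{X}_{1}\oplus\mathcal{X}_{-1}\oplus\mathcal{X}_{i}\oplus\mathcal{X}_{-i},$$ and each of the eigenspaces $\mathcal{X}_\lambda$, $\lambda=1,-1,i,-i$, is infinite-dimensional. 3. The systems $\{h_{4k}\}_{k=0,1,2,\ldots}$, $\{h_{4k+1}\}_{k=0,1,2,\ldots}$, $\{h_{4k+2}\}_{k=0,1,2,\ldots}$, $\{h_{4k+3}\}_{k=0,1,2,\ldots}$ form orthogonal bases of the eigenspaces $\mathcal{X}_{1}$, $\mathcal{X}_{i}$, $\mathcal{X}_{-1}$, $\mathcal{X}_{-i}$ respectively.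
   Context: $L^2(\mathbb{R})$ is the Hilbert space of complex-valued square-integrable functions with its standard inner product. The Fourier (Fourier–Plancherel) operator $\mathscr{F}$ is the unitary operator on $L^2(\mathbb{R})$ given by $$(\mathscr{F}x)(t)=\frac{1}{\sqrt{2\pi}}\int_{-\infty}^{\infty}x(\xi)e^{it\xi}\,d\xi$$ (literally for, e.g., Schwartz functions, and extended by continuity to $L^2(\mathbb{R})$). The creation operator $\mathfrak{a}^{\dagger}$ acts on Schwartz functions by $(\mathfrak{a}^{\dagger}x)(t)=-x'(t)+t\,x(t)$. An orthogonal basis of a Hilbert space is a complete orthogonal system of nonzero vectors (not necessarily normalized). *)

(* Defs.v *)
From HB Require Import structures.
From mathcomp Require Import all_boot all_order all_algebra ring_quotient.
From mathcomp Require Import all_classical all_reals all_analysis measurable_realfun.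
From mathcomp Require Import complex ring.

Set Implicit Arguments.
Unset Strict Implicit.
Unset Printing Implicit Defensive.

Import Order.TTheory GRing.Theory Num.Theory.
Import numFieldNormedType.Exports.

Local Open Scope classical_set_scope.
Local Open Scope ring_scope.
Local Open Scope complex_scope.
Local Open Scope quotient_scope.

Section ComplexFunctions.
Context {R : realType}.
Implicit Types f g : R -> R[i].

Notation mu := (@lebesgue_measure R).

(* The analysis library has no calculus on R[i]: measurability, integration and
   differentiation of complex-valued functions are taken componentwise. *)
Definition reF f : R -> R := fun t => complex.Re (f t).
Definition imF f : R -> R := fun t => complex.Im (f t).

Definition cmeasurable f :=
  measurable_fun [set: R] (reF f) /\ measurable_fun [set: R] (imF f).

Definition cintegral f : R[i] :=
  (\int[mu]_t reF f t) +i* (\int[mu]_t imF f t).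

Definition cderive f : R -> R[i] :=
  fun t => (derive1 (reF f) t) +i* (derive1 (imF f) t).

Definition cmod2 (z : R[i]) : R := complex.Re z ^+ 2 + complex.Im z ^+ 2.

Definition square_integrable f :=
  cmeasurable f /\ (\int[mu]_t (cmod2 (f t))%:E < +oo)%E.

Definition L2pred : {pred R -> R[i]} := [pred f | `[< square_integrable f >]].

End ComplexFunctions.

Section L2Space.
Context (R : realType).
Notation mu := (@lebesgue_measure R).

Lemma cmod2_ge0 (z : R[i]) : 0 <= cmod2 z.
Proof. by rewrite addr_ge0 ?sqr_ge0. Qed.

Lemma cmod2M (a z : R[i]) : cmod2 (a * z) = cmod2 a * cmod2 z.
Proof. by case: a => a b; case: z => c d; rewrite /cmod2 /=; ring. Qed.

Lemma cmod2D (z w : R[i]) : cmod2 (z + w) <= 2 * cmod2 z + 2 * cmod2 w.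
Proof.
case: z => a b; case: w => c d; rewrite /cmod2 /= -subr_ge0.
have -> : 2 * (a ^+ 2 + b ^+ 2) + 2 * (c ^+ 2 + d ^+ 2)
    - ((a + c) ^+ 2 + (b + d) ^+ 2) = (a - c) ^+ 2 + (b - d) ^+ 2 by ring.
by rewrite addr_ge0 ?sqr_ge0.
Qed.

Lemma measurable_cmod2 (f : R -> R[i]) : cmeasurable f ->
  measurable_fun [set: R] (fun t => (cmod2 (f t))%:E : \bar R).
Proof.
move=> [mr mi]; apply/measurable_EFinP.
by apply: measurable_funD; apply: measurable_funX.
Qed.

Lemma L2pred_submod_closed : submod_closed (@L2pred R).
Proof.
split=> [|a f g].
  apply/asboolP; split.
    by split; exact: measurable_cst.
  rewrite (eq_integral (cst 0%E)) ?integral0 ?ltry// => t _.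
  by rewrite /cmod2 /= !expr0n /= addr0.
move=> /asboolP[[mfr mfi] If] /asboolP[[mgr mgi] Ig]; apply/asboolP.
have mh : cmeasurable (a *: f + g).
  split.
    have -> : reF (a *: f + g) = fun t => complex.Re a * reF f t - complex.Im a * imF f t + reF g t.
      apply/funext => t; rewrite /reF /imF !fctE.
      by case: a (f t) (g t) => [? ?] [? ?] [? ?].
    apply: measurable_funD => //; apply: measurable_funB;
      by apply: measurable_funM => //; exact: measurable_cst.
  have -> : imF (a *: f + g) = fun t => complex.Re a * imF f t + complex.Im a * reF f t + imF g t.
    apply/funext => t; rewrite /reF /imF !fctE.
    by case: a (f t) (g t) => [? ?] [? ?] [? ?] /=; rewrite [X in X + _]addrC.
  apply: measurable_funD => //; apply: measurable_funD;
    by apply: measurable_funM => //; exact: measurable_cst.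
split=> //.
pose k t : \bar R := ((2 * cmod2 a)%:E * (cmod2 (f t))%:E + 2%:E * (cmod2 (g t))%:E)%E.
apply: (@le_lt_trans _ _ (\int[mu]_t k t)%E).
  apply: ge0_le_integral => //.
  - by move=> t _; rewrite lee_fin cmod2_ge0.
  - exact: measurable_cmod2.
  - by apply: emeasurable_funD; apply: measurable_funeM; exact: measurable_cmod2.
  - move=> t _; rewrite /k -!EFinM -EFinD lee_fin !fctE -mulrA -cmod2M.
    exact: cmod2D.
rewrite ge0_integralD//; last first.
- by apply: measurable_funeM; exact: measurable_cmod2.
- by move=> t _; rewrite -EFinM lee_fin mulr_ge0 ?cmod2_ge0.
- by apply: measurable_funeM; exact: measurable_cmod2.
- by move=> t _; rewrite -EFinM lee_fin !mulr_ge0 ?cmod2_ge0.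
rewrite !ge0_integralZl//; try exact: measurable_cmod2.
  by apply: lte_add_pinfty; apply: lte_mul_pinfty;
    rewrite ?lee_fin ?mulr_ge0 ?cmod2_ge0.
all: try by move=> t _; rewrite lee_fin cmod2_ge0.
by rewrite lee_fin mulr_ge0 ?cmod2_ge0.
Qed.

HB.instance Definition _ :=
  GRing.isSubmodClosed.Build _ _ (@L2pred R) L2pred_submod_closed.

Record L2fun := MkL2fun { L2val :> R -> R[i]; L2valP : L2val \in @L2pred R }.

HB.instance Definition _ := [isSub for L2val].
HB.instance Definition _ := [Choice of L2fun by <:].
HB.instance Definition _ := [SubChoice_isSubLmodule of L2fun by <:].

Definition ae_null : {pred L2fun} :=
  [pred f : L2fun | `[< \forall t \ae mu, f t = 0 >]].

Lemma ae_null_submod_closed : submod_closed ae_null.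
Proof.
split=> [|a f g].
  by apply/asboolP; exact: aeW.
move=> /asboolP f0 /asboolP g0; apply/asboolP.
apply: (@filterS2 _ _ (ae_filter_ringOfSetsType mu) _ _ _ _ f0 g0) => t ft gt.
by rewrite /= !fctE ft gt scaler0 addr0.
Qed.

HB.instance Definition _ :=
  GRing.isSubmodClosed.Build _ _ ae_null ae_null_submod_closed.

Definition L2 : Type := Quotient.quot ae_null.

HB.instance Definition _ := GRing.Zmodule.on L2.
HB.instance Definition _ := EqQuotient.on L2.

Definition L2scale (a : R[i]) (u : L2) : L2 := \pi_L2 (a *: repr u).

Lemma piL2Z (a : R[i]) (f : L2fun) : L2scale a (\pi_L2 f) = \pi_L2 (a *: f).
Proof.
apply/eqP; rewrite /L2scale -Quotient.idealrBE -scalerBr rpredZ//.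
rewrite Quotient.idealrBE; apply/eqP; exact: (@reprK _ L2).
Qed.

Lemma piL2D (f g : L2fun) : \pi_L2 f + \pi_L2 g = \pi_L2 (f + g).
Proof. by rewrite [RHS]Quotient.pi_add. Qed.

Lemma L2scaleA a b u : L2scale a (L2scale b u) = L2scale (a * b) u.
Proof. by elim/quotW: u => f; rewrite (piL2Z b) (piL2Z a) (piL2Z (a * b)) scalerA. Qed.

Lemma L2scale1 : left_id 1 L2scale.
Proof. by elim/quotW => f; rewrite piL2Z scale1r. Qed.

Lemma L2scaleDr : right_distributive L2scale +%R.
Proof.
move=> a; elim/quotW => f; elim/quotW => g.
by rewrite piL2D (piL2Z a f) (piL2Z a g) (piL2Z a (f + g)) piL2D scalerDr.
Qed.

Lemma L2scaleDl u : {morph L2scale^~ u : a b / a + b}.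
Proof. by elim/quotW: u => f a b; rewrite (piL2Z a) (piL2Z b) (piL2Z (a + b)) piL2D scalerDl. Qed.

HB.instance Definition _ := GRing.Zmodule_isLmodule.Build R[i] L2
  L2scaleA L2scale1 L2scaleDr L2scaleDl.

(* The class of f if f is square integrable, and 0 otherwise. *)
Definition toL2 (f : R -> R[i]) : L2 := \pi_L2 (insubd (0 : L2fun) f).

Definition inner (u v : L2) : R[i] :=
  cintegral (fun t => repr u t * conjc (repr v t)).

Definition L2norm (u : L2) : R := Num.sqrt (complex.Re (inner u u)).

Implicit Types (T S : L2 -> L2) (X : set L2) (lambda : R[i]).

Definition bounded_op T := exists M : R, forall u, L2norm (T u) <= M * L2norm u.

Definition unitary_op T :=
  [/\ linear T, forall u v, inner (T u) (T v) = inner u v &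
      forall v, exists u, T u = v].

Definition spectrum T : set R[i] :=
  [set lambda | ~ exists S, [/\ linear S, bounded_op S,
     forall u, S (T u - lambda *: u) = u &
     forall u, T (S u) - lambda *: S u = u]].

Definition eigspace T lambda : set L2 := [set u | T u = lambda *: u].

Definition is_eigenvalue T lambda := exists2 u, u != 0 & eigspace T lambda u.

(* X is meant to be a linear subspace. *)
Definition finite_dimensional X :=
  exists n (v : 'I_n -> L2),
    X = [set u | exists c : 'I_n -> R[i], u = \sum_i c i *: v i].

Definition orthogonal_sum n (X : 'I_n -> set L2) :=
  (forall i j, i != j -> forall u v, X i u -> X j v -> inner u v = 0) /\
  (forall u, exists! v : 'I_n -> L2, (forall i, X i (v i)) /\ u = \sum_i v i).

Definition orthogonal_basis X (e : nat -> L2) :=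
  [/\ forall n, X (e n) /\ e n != 0,
      forall m n, m != n -> inner (e m) (e n) = 0 &
      forall u, X u -> forall eps : R, 0 < eps ->
        exists n (c : 'I_n -> R[i]), L2norm (u - \sum_i c i *: e i) < eps].

Definition real_schwartz (f : R -> R) :=
  (forall n t, derivable (derive1n n f) t 1) /\
  (forall m n, exists M : R, forall t, `|t ^+ m * derive1n n f t| <= M).

Definition schwartz (f : R -> R[i]) :=
  real_schwartz (reF f) /\ real_schwartz (imF f).

Definition expi (x : R) : R[i] := cos x +i* sin x.

Definition fourier_integral (f : R -> R[i]) : R -> R[i] :=
  fun t => ((Num.sqrt (2 * pi))^-1)%:C *
           cintegral (fun xi => f xi * expi (t * xi)).

(* Schwartz functions being dense in L2, at most one operator satisfies this;
   Plancherel's theorem says that one does. *)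
Definition is_fourier T :=
  unitary_op T /\ forall f, schwartz f -> T (toL2 f) = toL2 (fourier_integral f).

Definition fourier : L2 -> L2 := xget (fun=> 0) is_fourier.

Definition creation (f : R -> R[i]) : R -> R[i] :=
  fun t => - cderive f t + t%:C * f t.

Definition hermite_fun n : R -> R[i] :=
  iter n creation (fun t => (expR (- (t ^+ 2 / 2)))%:C).

End L2Space.

(* Main.v *)
Require Import Defs.
From mathcomp Require Import all_boot all_order all_algebra.
From mathcomp Require Import all_classical all_reals all_analysis.
From mathcomp Require Import complex ring lra measurable_realfun ring_quotient.

(* A function [g] with [g e^(-e t^2)] integrable for every [e > 0] and orthogonal
   to all [t^n e^(-t^2/2)] vanishes almost everywhere: expanding exponentials
   under the integral sign, [g e^(-t^2/2)] is orthogonal to all Gaussians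
   [e^(-c (t - x)^2)], hence to their bounded pointwise limits, in particular to
   the indicators of all intervals. So the Hermite functions [h_n], which are
   orthogonal by integration by parts, are complete in L^2. By the recurrence
   [h_(n+1) = - h_n' + t h_n], the Fourier integral maps [h_n] to [i^n h_n]. By
   Riesz-Fischer, there is a unitary operator with [h_n |-> i^n h_n]; by Fubini,
   it has the same Hermite coefficients as the Fourier integral on Schwartz
   functions, and the uniqueness result, which applies to bounded functions,
   identifies the two without Plancherel. Operators diagonal in the Hermite basis
   (the Fourier operator, its resolvent and its spectral projections, which are
   polynomials in it) are then compared through their eigenvalues on [h_n]. *)

Set Implicit Arguments.
Unset Strict Implicit.
Unset Printing Implicit Defensive.

Import Order.TTheory GRing.Theory Num.Theory.
Import numFieldNormedType.Exports.

Local Open Scope classical_set_scope.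
Local Open Scope ring_scope.
Local Open Scope complex_scope.
Local Open Scope quotient_scope.

(** * Integrable functions on the line and Gaussian moments *)

Section RealIntegrals.
Context {R : realType}.
Implicit Types (f g q : R -> R) (t x : R).
Local Notation mu := (@lebesgue_measure R).
Local Notation L1 f := (mu.-integrable [set: R] (EFin \o f)).

(** The usual completeness proof ends with the injectivity of the Fourier transform on L^1. Real
    Gaussians avoid this detour: their expansion involves only real exponential series, and once the
    integrals over all balls vanish, Lebesgue differentiation concludes. Since F^4 is the identity
    on the Hermite functions, the projections and the resolvent are geometric sums in F of degree at
    most 3, and each claim about them becomes an identity between polynomials in z = i^n with z^4 =
    1. The operator [fourier] is obtained by choice, so nothing is known of it beyond [is_fourier].
    This determines its action on the h_n, which are Schwartz functions, and unitarity then turns F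
    h_n = i^n h_n into a formula for the Hermite coefficients of F u for every u. *)

Lemma L1_measurable f : L1 f -> measurable_fun [set: R] f.
Proof. by move=> /measurable_int/measurable_EFinP. Qed.

Lemma L1_le f g : measurable_fun [set: R] f -> (forall t, `|f t| <= g t) ->
  L1 g -> L1 f.
Proof.
move=> mf fg ig; apply: (le_integrable measurableT _ _ ig).
  exact/measurable_EFinP.
by move=> t _ /=; rewrite lee_fin (le_trans (fg t))// ler_norm.
Qed.

Lemma L1_eq f g : f =1 g -> L1 f -> L1 g.
Proof. by move=> /funext ->. Qed.

Lemma L1D f g : L1 f -> L1 g -> L1 (fun t => f t + g t).
Proof. by move=> If Ig; have := integrableD measurableT If Ig. Qed.

Lemma L1B f g : L1 f -> L1 g -> L1 (fun t => f t - g t).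
Proof. by move=> If Ig; have := integrableB measurableT If Ig. Qed.

Lemma L1Z a f : L1 f -> L1 (fun t => a * f t).
Proof. by move=> If; have := integrableZl measurableT a If. Qed.

Lemma L1_norm f : L1 f -> L1 (fun t => `|f t|).
Proof. exact: integrable_norm. Qed.

Lemma L1_sum n (F : nat -> R -> R) : (forall k, L1 (F k)) ->
  L1 (fun t => \sum_(k < n) F k t).
Proof.
move=> IF; elim: n => [|n IH].
  by under eq_fun do rewrite big_ord0; exact: integrable0.
by under eq_fun do rewrite big_ord_recr/=; exact: L1D.
Qed.

Lemma RintegralT_sum n (F : nat -> R -> R) : (forall k, L1 (F k)) ->
  \int[mu]_t (\sum_(k < n) F k t) = \sum_(k < n) \int[mu]_t F k t.
Proof.
move=> IF; elim: n => [|n IH].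
  by rewrite big_ord0; under eq_Rintegral do rewrite big_ord0; rewrite Rintegral_cst ?mul0r.
under eq_Rintegral do rewrite big_ord_recr/=.
by rewrite RintegralD//; [rewrite IH big_ord_recr|exact: L1_sum].
Qed.

Lemma L1_Mbounded f g M : L1 f -> measurable_fun [set: R] g ->
  (forall t, `|g t| <= M) -> L1 (fun t => f t * g t).
Proof.
move=> If mg gM; apply: (@L1_le _ (fun t => M * `|f t|)).
- by apply: measurable_funM => //; exact: L1_measurable.
- by move=> t; rewrite normrM mulrC ler_wpM2r.
- exact/L1Z/L1_norm.
Qed.

(** The integral over the half-line is given by the arctangent, and the function is even. It is the
    reference weight for every decay estimate below. *)
Lemma L1_oneDsqrV : L1 (fun t => (1 + t ^+ 2)^-1).
Proof.
have c : continuous (fun t : R => (1 + t ^+ 2)^-1) by exact: continuous_oneDsqrV.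
apply/integrableP; split.
  by apply/measurable_EFinP; exact: continuous_measurable_fun.
under eq_integral => t _.
  rewrite /= ger0_norm; last by rewrite invr_ge0 addr_ge0 ?sqr_ge0.
  over.
rewrite ge0_symfun_integralT//.
- rewrite (_ : [set x | _] = `[0, +oo[%classic); last first.
    by apply/seteqP; split => x/=; rewrite in_itv/= andbT.
  by rewrite integral0y_oneDsqr ltry.
- by move=> t; rewrite invr_ge0 addr_ge0 ?sqr_ge0.
- by move=> t; rewrite /= sqrrN.
Qed.

Lemma L1_decay f M : measurable_fun [set: R] f ->
  (forall t, (1 + t ^+ 2) * `|f t| <= M) -> L1 f.
Proof.
move=> mf fM; apply: (@L1_le _ (fun t => M * (1 + t ^+ 2)^-1)) => //.
  move=> t; have t0 : 0 < 1 + t ^+ 2 by rewrite ltr_pwDl ?sqr_ge0.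
  by rewrite ler_pdivlMr// mulrC.
exact/L1Z/L1_oneDsqrV.
Qed.

Lemma Rintegral_dominated (u : nat -> R -> R) f g :
  (forall n, measurable_fun [set: R] (u n)) -> measurable_fun [set: R] f ->
  {ae mu, forall t, u ^~ t @ \oo --> f t} ->
  (forall n t, `|u n t| <= g t) -> L1 g ->
  \int[mu]_t u n t @[n --> \oo] --> \int[mu]_t f t.
Proof.
move=> mun mf uf ug ig.
have uf' : {ae mu, forall t, [set: R] t -> (u n t)%:E @[n --> \oo] --> (f t)%:E}.
  apply: (@filterS _ _ (ae_filter_ringOfSetsType mu) _ _ _ uf) => t ut _.
  by apply/fine_cvgP; split; [exact: nearW|].
have ug' : {ae mu, forall t n, [set: R] t -> (`|(u n t)%:E| <= (EFin \o g) t)%E}.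
  by apply: aeW => t n _; rewrite /= lee_fin.
have [If _ c] := @dominated_convergence _ _ _ mu setT measurableT
  (fun n t => (u n t)%:E) (EFin \o f) (EFin \o g)
  (fun n => (measurable_EFinP _ _).2 (mun n)) ((measurable_EFinP _ _).2 mf) uf' ig ug'.
apply: fine_cvg; rewrite fineK//; exact: integrable_fin_num.
Qed.

(** A bound on the partial sums that is independent of n, hence a dominating function for
    integrating the exponential series term by term. *)
Lemma exp_series_norm_le x n :
  `|series (exp_coeff x) n| <= expR `|x|.
Proof.
apply: le_trans (ler_norm_sum _ _ _) _.
have -> : \sum_(0 <= k < n) `|exp_coeff x k| = series (exp_coeff `|x|) n.
  apply: eq_bigr => k _.
  by rewrite /exp_coeff /= normrM normrX normfV normr_nat.
apply: nondecreasing_cvgn_le; last exact: is_cvg_series_exp_coeff.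
apply: nondecreasing_series => k _ _.
by rewrite /exp_coeff /= divr_ge0// exprn_ge0.
Qed.

(* Term by term integration of the exponential series of [q]. *)
Lemma Rintegral_expR_eq0 f q : measurable_fun [set: R] f ->
  measurable_fun [set: R] q -> L1 (fun t => f t * expR `|q t|) ->
  (forall n, \int[mu]_t (f t * q t ^+ n) = 0) ->
  \int[mu]_t (f t * expR (q t)) = 0.
Proof.
move=> mf mq If f0.
pose u n t := f t * series (exp_coeff (q t)) n.
have Ik n : L1 (fun t => f t * exp_coeff (q t) n).
  apply: (@L1_le _ (fun t => `|f t * expR `|q t| |)) (L1_norm If).
    apply: measurable_funM => //; rewrite /exp_coeff/=.
    by apply: measurable_funM => //; exact: measurable_funX.
  move=> t; rewrite !normrM ler_wpM2l// [leRHS]ger0_norm ?expR_ge0//.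
  (* A single term is at most the whole partial sum at [|q t|], all of whose terms are
     nonnegative. *)
  have /= := exp_series_norm_le `|q t| n.+1.
  rewrite normr_id; apply: le_trans.
  rewrite /series/= big_nat_recr//= normrX normfV normr_nat.
  rewrite [leRHS]ger0_norm; first rewrite lerDr sumr_ge0// => k _.
    by rewrite /exp_coeff/= divr_ge0// exprn_ge0.
  rewrite addr_ge0 ?sumr_ge0// => [k _|];
    by rewrite /exp_coeff/= divr_ge0// exprn_ge0.
have uE n t : u n t = \sum_(k < n) (f t * exp_coeff (q t) k).
  by rewrite /u /series/= big_mkord mulr_sumr.
have Iu n : \int[mu]_t u n t = 0.
  under eq_Rintegral do rewrite uE.
  rewrite (RintegralT_sum n Ik).
  apply: big1 => k _.
  under eq_Rintegral => t _ do rewrite /exp_coeff/= mulrA mulrC.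
  rewrite RintegralZl//; first by rewrite f0 mulr0.
  (* Integrability of [f * q ^+ k] is recovered from that of the k-th term, multiplied by k!. *)
  apply: L1_eq (L1Z (k`!%:R) (Ik k)) => t.
  by rewrite /exp_coeff/= mulrCA [_ * (_ / _)]mulrC divfK.
have mu_ n : measurable_fun [set: R] (u n).
  rewrite (_ : u n = fun t => \sum_(k < n) (f t * exp_coeff (q t) k)).
    exact: (L1_measurable (L1_sum n Ik)).
  by apply/funext => t; exact: uE.
have me : measurable_fun [set: R] (fun t => f t * expR (q t)).
  by apply: measurable_funM => //; exact: measurableT_comp.
have := @Rintegral_dominated u (fun t => f t * expR (q t))
  (fun t => `|f t * expR `|q t| |) mu_ me _ _ (L1_norm If).
under eq_cvg do rewrite Iu.
move=> h; apply/esym.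
apply: (cvg_unique _ (cvg_cst _) (h _ _)) => //.
  apply: aeW => t; apply: cvgM; first exact: cvg_cst.
  exact: is_cvg_series_exp_coeff.
move=> n t; rewrite /u !normrM ler_wpM2l// [leRHS]ger0_norm ?expR_ge0//.
exact: exp_series_norm_le.
Qed.

End RealIntegrals.

(** * Vanishing Gaussian moments force a function to vanish *)

Section MomentUniqueness.
Context {R : realType}.
Implicit Types (f g p q : R -> R) (t x r e a c : R).
Local Notation mu := (@lebesgue_measure R).
Local Notation L1 f := (mu.-integrable [set: R] (EFin \o f)).

Lemma bernoulli_ineq x n : -1 <= x -> 1 + n%:R * x <= (1 + x) ^+ n.
Proof.
move=> x1; elim: n => [|n IH]; first by rewrite mul0r addr0 expr0.
have x0 : 0 <= 1 + x by rewrite addrC -lerBlDr sub0r.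
rewrite exprS; apply: le_trans (ler_wpM2l x0 IH).
rewrite -natr1 -subr_ge0 [X in 0 <= X](_ : _ = n%:R * x ^+ 2); last by ring.
by rewrite mulr_ge0 ?sqr_ge0.
Qed.

(** Bernoulli's inequality bounds the power from below by 1 - (2y)^n, and 2y < 1. *)
Lemma bernoulli_cvg1 y : 0 <= y < 2^-1 ->
  (1 - y ^+ n) ^+ (2 ^ n) @[n --> \oo] --> (1 : R).
Proof.
move=> /andP[y0 y2]; have y1 : y <= 1 by lra.
have yn n : 0 <= y ^+ n <= 1 by rewrite exprn_ge0//= exprn_ile1.
apply: (@squeeze_cvgr _ _ _ _ (fun n => 1 - (2 * y) ^+ n) (cst 1)); last 2 first.
- rewrite -[X in _ --> X](subr0 1); apply: cvgB; first exact: cvg_cst.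
  by apply: cvg_expr; rewrite ger0_norm; lra.
- exact: cvg_cst.
apply: nearW => n; have /andP[yn0 yn1] := yn n; apply/andP; split.
  have := @bernoulli_ineq (- y ^+ n) (2 ^ n)%N ltac:(lra).
  by rewrite natrX exprMn mulrN.
by apply: exprn_ile1; lra.
Qed.

(** By Bernoulli, (1 + y^n)^(2^n) is at least (2y)^n, while its product with (1 - y^n)^(2^n) is at
    most 1. The power is thus at most (2y)^(-n), and 2y > 1. *)
Lemma bernoulli_cvg0 y : 2^-1 < y <= 1 ->
  (1 - y ^+ n) ^+ (2 ^ n) @[n --> \oo] --> (0 : R).
Proof.
move=> /andP[y2 y1]; have y0 : 0 <= y by lra.
have yn n : 0 <= y ^+ n <= 1 by rewrite exprn_ge0//= exprn_ile1.
apply: (@squeeze_cvgr _ _ _ _ (cst 0) (fun n => ((2 * y)^-1) ^+ n)); last 2 first.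
- exact: cvg_cst.
- apply: cvg_expr; rewrite ger0_norm ?invr_ge0; last by lra.
  by rewrite invf_lt1; lra.
apply: nearW => n; have /andP[yn0 yn1] := yn n; apply/andP; split.
  by rewrite exprn_ge0// subr_ge0.
have b := @bernoulli_ineq (y ^+ n) (2 ^ n)%N ltac:(lra).
have y2n : 0 < (2 * y) ^+ n by apply: exprn_gt0; lra.
rewrite exprVn -[leRHS]mul1r ler_pdivlMr//.
apply: (@le_trans _ _ ((1 - y ^+ n) ^+ (2 ^ n) * (1 + y ^+ n) ^+ (2 ^ n))).
  rewrite ler_wpM2l ?exprn_ge0 ?subr_ge0//; apply: le_trans b.
  by rewrite natrX exprMn lerDr.
rewrite -exprMn; apply: exprn_ile1; first by nra.
by nra.
Qed.

(* Stone's trick: [1 - (1 - p ^+ n) ^+ (2 ^ n)] is a polynomial in [p] which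
   tends boundedly to the indicator of [p > 1/2]. *)
Lemma Rintegral_superlevel_eq0 f p : L1 f -> measurable_fun [set: R] p ->
  (forall t, 0 <= p t <= 1) -> {ae mu, forall t, p t != 2^-1} ->
  (forall n, \int[mu]_t (f t * p t ^+ n) = 0) ->
  \int[mu]_(t in [set t | 2^-1 < p t]) f t = 0.
Proof.
move=> If mp p01 p2 fp0.
have mf := L1_measurable If.
have Ifp n : L1 (fun t => f t * p t ^+ n).
  apply: (@L1_Mbounded _ _ _ 1) => //; first exact: measurable_funX.
  move=> t; have /andP[p0 p1] := p01 t.
  by rewrite ger0_norm ?exprn_ge0// exprn_ile1.
have polyE (P : {poly R}) t :
    f t * P.[p t] = \sum_(k < size P) P`_k * (f t * p t ^+ k).
  by rewrite horner_coef mulr_sumr; apply: eq_bigr => k _; rewrite mulrCA.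
have poly0 (P : {poly R}) : \int[mu]_t (f t * P.[p t]) = 0.
  under eq_Rintegral do rewrite polyE.
  rewrite (RintegralT_sum _ (fun k => L1Z P`_k (Ifp k))).
  by apply: big1 => k _; rewrite RintegralZl// fp0 mulr0.
have mpoly (P : {poly R}) : measurable_fun [set: R] (fun t => f t * P.[p t]).
  under eq_fun do rewrite polyE.
  exact: (L1_measurable (L1_sum _ (fun k => L1Z P`_k (Ifp k)))).
pose Q n : {poly R} := 1 - (1 - 'X^n) ^+ (2 ^ n).
have QE n t : (Q n).[p t] = 1 - (1 - p t ^+ n) ^+ (2 ^ n) by rewrite /Q !hornerE.
rewrite Rintegral_mkcond; set D := [set t | _].
have mD : measurable D.
  rewrite (_ : D = [set: R] `&` p @^-1` `]2^-1, +oo[%classic); last first.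
    by rewrite setTI; apply/seteqP; split => t; rewrite /D/= in_itv/= andbT.
  exact: mp.
have := @Rintegral_dominated _ (fun n t => f t * (Q n).[p t]) (f \_ D)
  (fun t => `|f t|) (fun n => mpoly (Q n)).
under eq_cvg do rewrite poly0.
move=> h; apply/esym; apply: (cvg_unique _ (cvg_cst _) (h _ _ _ _)) => //.
- by apply/(measurable_restrictT _ mD); exact: measurable_funTS.
(* Where [p t] equals 1/2 the powers would tend to 1/e, so this level set has to be null. *)
- apply: (@filterS _ _ (ae_filter_ringOfSetsType mu) _ _ _ p2) => t pt2.
  have /andP[pt0 pt1] := p01 t.
  under eq_cvg do rewrite QE.
  have -> : (f \_ D) t = f t * (1 - (p t <= 2^-1)%R%:R).
    have -> : (p t <= 2^-1) = (t \notin D) by rewrite mem_setE leNgt.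
    by rewrite patchE; case: (t \in D); rewrite /= ?subr0 ?mulr1 ?subrr ?mulr0.
  apply: cvgM; first exact: cvg_cst.
  apply: cvgB; first exact: cvg_cst.
  have [pt|pt] := leP (p t) 2^-1.
    by apply: bernoulli_cvg1; rewrite pt0/= lt_neqAle pt2.
  by apply: bernoulli_cvg0; rewrite pt.
- move=> n t; rewrite QE normrM ler_piMr//.
  have /andP[pt0 pt1] := p01 t.
  have ptn : 0 <= p t ^+ n <= 1 by rewrite exprn_ge0//= exprn_ile1.
  have : 0 <= (1 - p t ^+ n) ^+ (2 ^ n) <= 1.
    by rewrite exprn_ge0 ?exprn_ile1//; lra.
  by move=> ?; rewrite ger0_norm; lra.
- exact: L1_norm.
Qed.

(** Balls of radius 1/(n+1) shrink nicely to their centre, so at almost every point the value of f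
    is a limit of averages that are all zero. *)
Lemma ball_Rintegral_eq0_ae f : L1 f ->
  (forall x r, 0 < r -> \int[mu]_(t in ball x r) f t = 0) ->
  {ae mu, forall t, f t = 0}.
Proof.
move=> If f0.
have loc : locally_integrable [set: R] f.
  by apply: open_integrable_locally => //; exact: openT.
pose E x n : set R := ball x n.+1%:R^-1.
have hE x : nicely_shrinking x (E x).
  split; first by move=> n; exact: measurable_ball.
  exists (1, fun n => n.+1%:R^-1%:pos); split => //=.
  - exact: cvg_harmonic.
  - by move=> n; exact: subset_refl.
  - by move=> n; rewrite mul1e.
have := lebesgue_differentiation loc.
apply: (@filterS _ _ (ae_filter_ringOfSetsType mu)) => t.
move=> /(nice_lebesgue_differentiation hE loc).
have iE n : (\int[mu]_(y in E t n) (f y)%:E)%E = 0%E.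
  have := f0 t n.+1%:R^-1 ltac:(by rewrite invr_gt0).
  rewrite /Rintegral -/(E t n) => /eqP; rewrite fine_eq0; first by move/eqP.
  have : mu.-integrable (E t n) (EFin \o f).
    by apply: integrableS If => //; exact: measurable_ball.
  by move=> h; apply: (integrable_fin_num _ h); exact: measurable_ball.
rewrite (_ : (fun n => _) = cst 0%E); last first.
  by apply/funext => n; rewrite iE mule0.
move=> /(cvg_lim (@ereal_hausdorff R)).
by rewrite lim_cst; [case|exact: ereal_hausdorff].
Qed.

Lemma exprn_le_expR x n : 0 <= x -> x ^+ n <= n`!%:R * expR x.
Proof.
move=> x0; case: n => [|n].
  by rewrite expr0 fact0 mul1r (le_trans _ (expR_ge1Dx x))// lerDl.
rewrite -ler_pdivrMl ?ltr0n ?fact_gt0// mulrC.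
by apply: le_trans (expR_ge1Dxn n x0); rewrite lerDr.
Qed.

(** The constant comes from |t^n| <= 1 + (t^2)^n and (e t^2)^n <= n! exp(e t^2), one term of the
    exponential series. *)
Lemma poly_gauss_bounded e n : 0 < e ->
  exists M : R, forall t : R, `|t ^+ n * expR (- (e * t ^+ 2))| <= M.
Proof.
move=> e0; exists (1 + n`!%:R / e ^+ n) => t.
rewrite normrM (ger0_norm (expR_ge0 _)) expRN ler_pdivrMr ?expR_gt0//.
have et0 : 0 <= e * t ^+ 2 by rewrite mulr_ge0 ?sqr_ge0// ltW.
have e1 : 1 <= expR (e * t ^+ 2) by apply: le_trans (expR_ge1Dx _); rewrite lerDl.
have tn : `|t ^+ n| <= 1 + (t ^+ 2) ^+ n.
  rewrite -exprM mulnC exprM -real_normK ?num_real//.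
  have := normr_ge0 (t ^+ n); set z := `|_|; nra.
apply: le_trans tn _; rewrite mulrDl mul1r lerD// mulrAC ler_pdivlMr ?exprn_gt0//.
by rewrite -exprMn mulrC exprn_le_expR.
Qed.

(** A weighted AM-GM inequality. It absorbs a factor exp(|s t|) into half of the Gaussian exp(-a
    t^2), at the cost of a constant. *)
Lemma normM_le_sqr s t a : 0 < a -> `|s * t| <= s ^+ 2 / a + a / 2 * t ^+ 2.
Proof.
move=> a0; rewrite -(@ler_pM2l _ (2 * a)); last lra.
rewrite (_ : 2 * a * (_ + _) = 2 * s ^+ 2 + (a * t) ^+ 2); last by field; lra.
have : 0 <= (`|s| - a * `|t|) ^+ 2 by rewrite sqr_ge0.
by rewrite normrM sqrrB exprMn !real_normK ?num_real//; nra.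
Qed.

Section Moments.
Variable g : R -> R.
Hypothesis mg : measurable_fun [set: R] g.
Hypothesis Ig : forall e, 0 < e -> L1 (fun t => g t * expR (- (e * t ^+ 2))).

(** The exponent is split in two halves: one keeps g integrable, the other bounds t^n. *)
Lemma L1_gauss_moment e n : 0 < e ->
  L1 (fun t => g t * t ^+ n * expR (- (e * t ^+ 2))).
Proof.
move=> e0; have e2 : 0 < e / 2 by lra.
have [M tM] := poly_gauss_bounded n e2.
apply: (L1_eq _ (L1_Mbounded (Ig e2) _ tM)); last first.
  apply: measurable_funM; first exact: measurable_funX.
  apply: measurableT_comp => //; apply: measurableT_comp => //.
  by apply: measurable_funM => //; exact: measurable_funX.
move=> t /=; rewrite [e in RHS](_ : _ = e / 2 + e / 2); last by lra.
by rewrite mulrDl opprD expRD; ring.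
Qed.

Let moments0 a := forall n, \int[mu]_t (g t * t ^+ n * expR (- (a * t ^+ 2))) = 0.

Let mgauss (a : R) : measurable_fun [set: R] (fun t : R => expR (- (a * t ^+ 2))).
Proof.
apply: measurableT_comp => //; apply: measurableT_comp => //.
by apply: measurable_funM => //; exact: measurable_funX.
Qed.

Let mmoment a n :
  measurable_fun [set: R] (fun t => g t * t ^+ n * expR (- (a * t ^+ 2))).
Proof.
by apply: measurable_funM => //; apply: measurable_funM => //; exact: measurable_funX.
Qed.

Lemma moments0_step a c : 0 <= c -> c < a -> moments0 a -> moments0 (a + c).
Proof.
move=> c0 ca ga n.
under eq_Rintegral => t _ do rewrite mulrDl opprD expRD mulrA.
apply: (Rintegral_expR_eq0 (q := fun t => - (c * t ^+ 2)) (mmoment a n)).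
- apply: measurableT_comp => //.
  by apply: measurable_funM => //; exact: measurable_funX.
- have ac : 0 < a - c by lra.
  apply: L1_eq (L1_gauss_moment n ac) => t.
  rewrite -!mulrA -expRD normrN ger0_norm; last first.
    by rewrite mulr_ge0 ?sqr_ge0.
  by congr (_ * (_ * expR _)); ring.
- move=> m; under eq_Rintegral => t _.
    rewrite (_ : _ * _ ^+ m =
      (- c) ^+ m * (g t * t ^+ (n + 2 * m) * expR (- (a * t ^+ 2)))); last first.
      by rewrite exprD exprM -[- (c * _)]mulNr [in LHS]exprMn; ring.
    over.
  rewrite RintegralZl//; first by rewrite ga mulr0.
  by apply: L1_gauss_moment; lra.
Qed.

Hypothesis g0 : forall n, \int[mu]_t (g t * t ^+ n * expR (- (t ^+ 2 / 2))) = 0.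

(* The expansion of [e^(-c t^2)] against [e^(-a t^2)] is dominated only for
   [c < a], hence the successive steps of length 1/4. *)
Lemma moments0_ge_half c : 0 <= c -> moments0 (2^-1 + c).
Proof.
have half : moments0 2^-1.
  by move=> n; under eq_Rintegral => t _ do rewrite mulrC [2^-1 * _]mulrC mulrC.
suff h n : forall d : R, 0 <= d <= n%:R / 4 -> moments0 (2^-1 + d).
  move=> c0; apply: (h (Num.truncn (4 * c)).+1); rewrite c0/=.
  by rewrite ler_pdivlMr// mulrC ltW// truncnS_gt.
elim: n => [|n IH] d /andP[d0 dn].
  have -> : d = 0 by lra.
  by rewrite addr0.
have [dn'|dn'] := leP d (n%:R / 4); first by apply: IH; rewrite d0.
have n0 : 0 <= n%:R :> R by [].
rewrite (_ : 2^-1 + d = 2^-1 + n%:R / 4 + (d - n%:R / 4)); last by ring.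
move: dn; rewrite -natr1 => dn.
apply: moments0_step; [lra|lra|apply: IH].
by rewrite lexx andbT; lra.
Qed.

(** With a = 1/2 + c, the exponent t^2/2 + c (t - x)^2 equals a t^2 - 2 c x t + c x^2. Only exp(2 c
    x t) remains to be expanded against exp(-a t^2), whose moments vanish. *)
Lemma gauss_translate0 c x : 0 <= c ->
  \int[mu]_t (g t * expR (- (t ^+ 2 / 2)) * expR (- (c * (t - x) ^+ 2))) = 0.
Proof.
move=> c0; pose a := 2^-1 + c; have a0 : 0 < a by rewrite /a; lra.
have E t : g t * expR (- (t ^+ 2 / 2)) * expR (- (c * (t - x) ^+ 2)) =
    expR (- (c * x ^+ 2)) * (g t * expR (- (a * t ^+ 2)) * expR (2 * c * x * t)).
  rewrite -!mulrA [RHS]mulrCA -!expRD; congr (_ * expR _).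
  by rewrite /a; field.
have mfa : measurable_fun [set: R] (fun t => g t * expR (- (a * t ^+ 2))).
  exact: measurable_funM.
have ml (s : R) : measurable_fun [set: R] (fun t => s * t).
  exact: measurable_funM.
have Iabs : L1 (fun t => g t * expR (- (a * t ^+ 2)) * expR `|2 * c * x * t|).
  move: (2 * c * x) => s.
  have a4 : 0 < a / 2 by lra.
  apply: (@L1_le _ _ (fun t => expR (s ^+ 2 / a) * `|g t * expR (- (a / 2 * t ^+ 2))|)).
  - apply: measurable_funM => //; apply: measurableT_comp => //.
    exact: measurableT_comp.
  - move=> t; have := normM_le_sqr s t a0; set w := `|s * t| => w_le.
    rewrite !normrM !(ger0_norm (expR_ge0 _)) [leRHS]mulrCA -mulrA.
    by rewrite ler_wpM2l// -!expRD ler_expR; lra.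
  - exact/L1Z/L1_norm/Ig.
under eq_Rintegral do rewrite E.
rewrite RintegralZl//; last first.
  apply: L1_le (L1_norm Iabs).
    by apply: measurable_funM => //; exact: measurableT_comp.
  move=> t; rewrite normrM [leRHS]normrM ler_wpM2l// !(ger0_norm (expR_ge0 _)).
  by rewrite ler_expR ler_norm.
rewrite (Rintegral_expR_eq0 (q := fun t => 2 * c * x * t) mfa) ?mulr0// => n.
under eq_Rintegral => t _ do
  rewrite exprMn mulrCA mulrAC -[g t * _ * _]mulrAC.
rewrite RintegralZl//; first by rewrite moments0_ge_half ?mulr0.
exact: L1_gauss_moment.
Qed.

Lemma moments_eq0_ae : {ae mu, forall t, g t = 0}.
Proof.
pose f t := g t * expR (- (t ^+ 2 / 2)).
have If : L1 f.
  apply: L1_eq (@Ig 2^-1 ltac:(lra)) => t.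
  by rewrite /f mulrC [2^-1 * _]mulrC mulrC.
have : {ae mu, forall t, f t = 0}.
  apply: ball_Rintegral_eq0_ae => // x r r0.
  (* This rate makes the bump [p] drop to 1/2 exactly at distance r from x, so the ball is a
     superlevel set of [p]. *)
  pose c := ln 2 / r ^+ 2.
  have ln2 : 0 < ln 2 :> R by rewrite ln_gt0// ltr1n.
  have c0 : 0 < c by rewrite divr_gt0// exprn_gt0.
  pose p t := expR (- (c * (t - x) ^+ 2)).
  have pE t : (2^-1 < p t) = (`|t - x| < r).
    rewrite /p expRN ltf_pV2 ?posrE ?expR_gt0//.
    rewrite -[X in _ < X](@lnK _ 2) ?posrE// ltr_expR.
    rewrite /c mulrAC ltr_pdivrMr ?exprn_gt0// ltr_pM2l//.
    by rewrite -[RHS]ltr_sqr ?nnegrE ?(ltW r0)// real_normK ?num_real.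
  rewrite (_ : ball x r = [set t | 2^-1 < p t]); last first.
    by apply/seteqP; split => t /=; rewrite pE /ball/= distrC.
  apply: Rintegral_superlevel_eq0 => //.
  - apply: measurableT_comp => //; apply: measurableT_comp => //.
    by apply: measurable_funM => //; apply: measurable_funX; exact: measurable_funB.
  - move=> t; rewrite expR_ge0/= expR_le1 oppr_le0 mulr_ge0 ?sqr_ge0//.
    exact: ltW.
  (* The level set of 1/2 consists of the two end points of the ball. *)
  - exists [set x - r; x + r]; split.
    + by apply: measurableU; exact: measurable_set1.
    + exact/countable_lebesgue_measure0/finite_set_countable/finite_set2.
    + move=> t /= /negP; rewrite negbK => /eqP.
      rewrite /p expRN => /invr_inj; rewrite -[X in _ = X](@lnK _ 2) ?posrE//.
      move=> /expR_inj; rewrite /c mulrAC => /(canRL (divfK _)).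
      rewrite sqrf_eq0 (gt_eqF r0) => /(_ isT)/mulfI.
      rewrite (gt_eqF ln2) => /(_ isT)/eqP; rewrite eqf_sqr.
      by move=> /orP[] /eqP; [right|left]; lra.
  (* The n-th power of the bump is again a Gaussian centred at x, with rate n c. *)
  - move=> n; have cn : 0 <= c * n%:R by rewrite mulr_ge0// ltW.
    rewrite -(gauss_translate0 x cn); apply: eq_Rintegral => t _; rewrite /f /p -expRM_natr.
    by congr (_ * expR _); ring.
apply: (@filterS _ _ (ae_filter_ringOfSetsType mu)) => t /eqP.
by rewrite /f mulf_eq0 expR_eq0 orbF => /eqP.
Qed.

End Moments.

End MomentUniqueness.

(** * Hermite functions and their Fourier integrals *)

Section HermiteFunctions.
Context {R : realType}.
Implicit Types (p q : {poly R}) (f g : R -> R) (t x : R).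
Local Notation mu := (@lebesgue_measure R).
Local Notation L1 f := (mu.-integrable [set: R] (EFin \o f)).

Definition gpoly p t : R := p.[t] * expR (- (t ^+ 2 / 2)).

Lemma gpolyD p q t : gpoly (p + q) t = gpoly p t + gpoly q t.
Proof. by rewrite /gpoly hornerD mulrDl. Qed.

Lemma gpolyB p q t : gpoly (p - q) t = gpoly p t - gpoly q t.
Proof. by rewrite /gpoly hornerD hornerN mulrBl. Qed.

Lemma gpolyZ a p t : gpoly (a *: p) t = a * gpoly p t.
Proof. by rewrite /gpoly hornerZ mulrA. Qed.

Lemma gpolyXM p t : gpoly ('X * p) t = t * gpoly p t.
Proof. by rewrite /gpoly hornerM hornerX mulrA. Qed.

Lemma is_derive_gpoly p t : is_derive t 1 (gpoly p) (gpoly (p^`() - 'X * p) t).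
Proof.
have d1 : is_derive t 1 (fun t : R => - (t ^+ 2 / 2)) (- t).
  by apply: is_derive_eq; rewrite /GRing.scale/=; field.
have d2 := is_derive1_comp (is_derive_expR _) d1.
have := is_deriveM (is_derive_poly p t) d2.
rewrite /comp => d3; apply: (is_derive_eq d3).
by rewrite /gpoly /GRing.scale/= hornerD hornerN hornerM hornerX; ring.
Qed.

Lemma derivable_gpoly p t : derivable (gpoly p) t 1.
Proof. by have [] := is_derive_gpoly p t. Qed.

Lemma derive1_gpoly p : derive1 (gpoly p) = gpoly (p^`() - 'X * p).
Proof.
by apply/funext => t; rewrite derive1E; by have [] := is_derive_gpoly p t.
Qed.

Lemma continuous_gpoly p : continuous (gpoly p).
Proof.
move=> t; apply: differentiable_continuous; apply/derivable1_diffP.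
exact: derivable_gpoly.
Qed.

Lemma measurable_gpoly p : measurable_fun [set: R] (gpoly p).
Proof. exact: continuous_measurable_fun (@continuous_gpoly p). Qed.

Lemma gpoly_bounded p : exists M : R, forall t, `|gpoly p t| <= M.
Proof.
have half0 : 0 < 2^-1 :> R by [].
have h k := poly_gauss_bounded k half0.
pose M k := sval (cid (h k)).
exists (\sum_(k < size p) `|p`_k| * M k) => t.
rewrite /gpoly horner_coef mulr_suml; apply: le_trans (ler_norm_sum _ _ _) _.
apply: ler_sum => k _; rewrite -mulrA normrM ler_wpM2l//.
have := svalP (cid (h k)) t; by rewrite [2^-1 * _]mulrC.
Qed.

Lemma gpoly_decay p : exists M : R, forall t, (1 + t ^+ 2) * `|gpoly p t| <= M.
Proof.
have [M pM] := gpoly_bounded ((1 + 'X^2) * p); exists M => t.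
apply: le_trans (pM t).
rewrite /gpoly hornerM -[_ * p.[t] * _]mulrA [leRHS]normrM ler_wpM2r//.
by rewrite hornerD hornerC hornerXn ler_norm.
Qed.

Lemma L1_gpoly p : L1 (gpoly p).
Proof.
by have [M pM] := gpoly_decay p; apply: (L1_decay _ pM); exact: measurable_gpoly.
Qed.

Lemma derive1n_gpoly n p : exists q, derive1n n (gpoly p) = gpoly q.
Proof.
elim: n => [|n [q qE]]; first by exists p.
by exists (q^`() - 'X * q); rewrite derive1nS qE derive1_gpoly.
Qed.

Lemma real_schwartz_gpoly p : real_schwartz (gpoly p).
Proof.
split=> [n t|m n].
  by have [q ->] := derive1n_gpoly n p; exact: derivable_gpoly.
have [q ->] := derive1n_gpoly n p.
have [M qM] := gpoly_bounded ('X^m * q); exists M => t.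
by apply: le_trans (qM t); rewrite /gpoly hornerM hornerXn mulrA.
Qed.

(** The Hermite polynomials in the physicists' normalization. One of the two factors t is explicit
    in the creation operator, the other comes from differentiating the Gaussian. *)
Fixpoint hermite_poly n : {poly R} :=
  if n is m.+1 then 2 *: ('X * hermite_poly m) - (hermite_poly m)^`() else 1.

Lemma size_hermite_poly n : size (hermite_poly n) = n.+1.
Proof.
elim: n => [|n IH]; first by rewrite size_poly1.
have s2 : size (2 *: ('X * hermite_poly n)) = n.+2.
  rewrite size_scale ?pnatr_eq0// mulrC size_mulX ?IH//.
  by rewrite -size_poly_eq0 IH.
rewrite /= size_polyDl s2// size_polyN ltnS.
by apply: (leq_trans (size_poly _ _)); rewrite IH.
Qed.

Lemma reF_real f : reF (fun t => (f t)%:C) = f. Proof. by []. Qed.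

Lemma imF_real f : imF (fun t => (f t)%:C) = cst 0. Proof. by []. Qed.

Lemma hermite_funE n :
  hermite_fun n = fun t : R => (gpoly (hermite_poly n) t)%:C.
Proof.
elim: n => [|n IH].
  by apply/funext => t /=; rewrite /gpoly hornerC mul1r.
rewrite /hermite_fun iterS -/(hermite_fun n) IH; apply/funext => t.
rewrite /creation /cderive reF_real imF_real derive1_gpoly derive1_cst/=.
rewrite !gpolyB gpolyZ !gpolyXM.
apply/eqP; rewrite eq_complex/= !mulr0 !mul0r !subr0 !addr0 oppr0.
by apply/andP; split => //; apply/eqP; ring.
Qed.

Lemma schwartz_hermite_fun n : schwartz (@hermite_fun R n).
Proof.
rewrite hermite_funE; split; rewrite ?reF_real ?imF_real.
  exact: real_schwartz_gpoly.
have -> : cst 0 = gpoly 0 by apply/funext => t; rewrite /gpoly horner0 mul0r.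
exact: real_schwartz_gpoly.
Qed.

(** The fundamental theorem of calculus on [-(n+1), n+1] leaves boundary values of size at most
    M/(n+1), by the decay of F. *)
Lemma Rintegral_derive_eq0 (F f : R -> R) : (forall t : R, is_derive t 1 F (f t)) ->
  continuous f -> L1 f ->
  (exists M : R, forall t : R, (1 + t ^+ 2) * `|F t| <= M) ->
  \int[mu]_t f t = 0.
Proof.
move=> dF cf If [M FM].
pose D (n : nat) : set R := `[- n.+1%:R, n.+1%:R]%classic.
have FE n : \int[mu]_(t in D n) f t = F n.+1%:R - F (- n.+1%:R).
  rewrite /Rintegral (@continuous_FTC2 _ f F)//.
  - by rewrite gtrN.
  - exact: continuous_subspaceT.
  - split.
    + by move=> t _; have [] := dF t.
    + apply: cvg_at_right_filter; apply: differentiable_continuous.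
      by apply/derivable1_diffP; have [] := dF (- n.+1%:R).
    + apply: cvg_at_left_filter; apply: differentiable_continuous.
      by apply/derivable1_diffP; have [] := dF n.+1%:R.
  - by move=> t _; rewrite derive1E; have [] := dF t.
have mf := L1_measurable If.
have h : \int[mu]_t (f \_ (D n)) t @[n --> \oo] --> \int[mu]_t f t.
  apply: (@Rintegral_dominated _ (fun n => f \_ (D n)) f (fun t => `|f t|)) => //.
  - move=> n; apply/(measurable_restrictT _ (measurable_itv _)).
    exact: measurable_funTS.
  - apply: aeW => t; apply: cvg_near_cst.
    exists (Num.truncn `|t|) => // n /= tn.
    rewrite patchE mem_set// /D/= in_itv/= -ler_norml ltW//.
    by apply: lt_le_trans (truncnS_gt _) _; rewrite ler_nat ltnS.
  - move=> n t; rewrite patchE; case: ifP => // _.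
    by rewrite /point/= normr0.
  - exact: L1_norm.
apply/esym; apply: (cvg_unique _ _ h) => //.
rewrite (_ : (fun n => _) = fun n => F n.+1%:R - F (- n.+1%:R)); last first.
  by apply/funext => n; rewrite -FE [RHS]Rintegral_mkcond.
have M0 : 0 <= M by apply: le_trans (FM 0); rewrite mulr_ge0// addr_ge0 ?sqr_ge0.
have Fdecay t : 1 <= `|t| -> `|F t| <= M / `|t|.
  move=> t1; rewrite ler_pdivlMr; last lra.
  apply: le_trans (FM t); rewrite mulrC ler_wpM2r// -real_normK ?num_real//.
  by nra.
have inv0 : M / n.+1%:R @[n --> \oo] --> (0 : R).
  rewrite -[X in _ --> X](mulr0 M); apply: cvgM; first exact: cvg_cst.
  exact: cvg_harmonic.
have lim0 (s : R) : `|s| = 1 -> F (s * n.+1%:R) @[n --> \oo] --> (0 : R).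
  move=> s1.
  apply: (@squeeze_cvgr _ _ _ _ (fun n => - (M / n.+1%:R)) (fun n => M / n.+1%:R)).
  - apply: nearW => n; rewrite -ler_norml.
    have sn : `|s * n.+1%:R| = n.+1%:R by rewrite normrM s1 mul1r normr_nat.
    by rewrite -[in leRHS]sn Fdecay// sn ler1n.
  - by rewrite -oppr0; apply: cvgN.
  - exact: inv0.
rewrite -(subr0 0); apply: cvgB.
  by have := lim0 1 (normr1 _); under eq_fun do rewrite mul1r.
by have := lim0 (-1) (normrN1 _); under eq_fun do rewrite mulN1r.
Qed.

(** As a form on polynomials this is the scalar product with weight e^(-t^2). *)
Definition gdot p q : R := \int[mu]_t (gpoly p t * gpoly q t).

Lemma L1_gpolyM p q : L1 (fun t => gpoly p t * gpoly q t).
Proof.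
have [M qM] := gpoly_bounded q.
exact: (L1_Mbounded (L1_gpoly p) (measurable_gpoly q) qM).
Qed.

Lemma gdotC p q : gdot p q = gdot q p.
Proof. by apply: eq_Rintegral => t _; rewrite mulrC. Qed.

Lemma gdotDr p q r : gdot p (q + r) = gdot p q + gdot p r.
Proof.
rewrite -RintegralD//; try exact: L1_gpolyM.
by apply: eq_Rintegral => t _; rewrite gpolyD mulrDr.
Qed.

Lemma gdotZr a p q : gdot p (a *: q) = a * gdot p q.
Proof.
rewrite -RintegralZl//; last exact: L1_gpolyM.
by apply: eq_Rintegral => t _; rewrite gpolyZ mulrCA.
Qed.

Lemma gdotDl p q r : gdot (p + q) r = gdot p r + gdot q r.
Proof. by rewrite ![gdot _ r]gdotC gdotDr. Qed.

Lemma gdotBl p q r : gdot (p - q) r = gdot p r - gdot q r.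
Proof. by rewrite -scaleN1r gdotDl ![gdot _ r]gdotC gdotZr mulN1r. Qed.

Lemma gdotXl p q : gdot ('X * p) q = gdot p ('X * q).
Proof. by apply: eq_Rintegral => t _; rewrite !gpolyXM; ring. Qed.

Lemma gdot_by_parts p q :
  gdot (p^`() - 'X * p) q + gdot p (q^`() - 'X * q) = 0.
Proof.
rewrite -RintegralD//; try exact: L1_gpolyM.
apply: (@Rintegral_derive_eq0 (fun t => gpoly p t * gpoly q t)).
- move=> t; have := is_deriveM (is_derive_gpoly p t) (is_derive_gpoly q t).
  by move=> d; apply: (is_derive_eq d); rewrite /GRing.scale/=; ring.
- move=> t; apply: cvgD; apply: cvgM; exact: continuous_gpoly.
- apply: L1D; exact: L1_gpolyM.
- have [M pM] := gpoly_decay p; have [N qN] := gpoly_bounded q.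
  exists (M * N) => t; rewrite normrM mulrA.
  by apply: ler_pM => //; rewrite mulr_ge0// addr_ge0 ?sqr_ge0.
Qed.

(** The adjoint of creation is annihilation, d/dt + t, and it sends q e^(-t^2/2) to q'
    e^(-t^2/2). *)
Lemma gdot_hermiteS n q :
  gdot (hermite_poly n.+1) q = gdot (hermite_poly n) q^`().
Proof.
set p := hermite_poly n.
have -> : hermite_poly n.+1 = 'X * p - (p^`() - 'X * p).
  by rewrite /= -/p (_ : 2 *: _ = 'X * p + 'X * p) ?opprB ?addrA// -mulr2n scaler_nat.
rewrite gdotBl gdotXl -[in RHS](subrK ('X * q) q^`()) gdotDr.
have /eqP := gdot_by_parts p q; rewrite addr_eq0 => /eqP ->.
by rewrite opprK addrC.
Qed.

(** Differentiating the recurrence of H_(n+2) gives 2 H_(n+1) plus 2(n+1) times 2 X H_n - H_n', and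
    the latter factor is H_(n+1) again. *)
Lemma deriv_hermiteS n :
  (hermite_poly n.+1)^`() = (2 * n.+1)%:R *: hermite_poly n.
Proof.
elim: n => [|n IH].
  by rewrite /= derivB derivZ derivM derivX derivC mulr0 addr0 mul1r derivC subr0 muln1.
have HS m : hermite_poly m.+1 = 2 *: ('X * hermite_poly m) - (hermite_poly m)^`().
  by [].
rewrite HS derivB derivZ derivM derivX mul1r IH derivZ -scalerAr.
rewrite scalerDr -addrA scalerA mulrC -scalerA -scalerBr -HS -scalerDl.
by rewrite -natrD -mulnS.
Qed.

(** The two preceding lemmas lower both indices together. When one of them reaches 0, the derivative
    of the constant H_0 appears. *)
Lemma gdot_hermite_neq m n : m != n ->
  gdot (hermite_poly m) (hermite_poly n) = 0.
Proof.
elim: m n => [|m IH] [|n] // mn.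
- rewrite gdotC gdot_hermiteS /= derivC -(scale0r 0) gdotZr mul0r //.
- by rewrite gdot_hermiteS /= derivC -(scale0r 0) gdotZr mul0r.
- by rewrite gdot_hermiteS deriv_hermiteS gdotZr IH ?mulr0.
Qed.

(** The same recursion yields the value 2^n n! sqrt(pi), starting from the Gaussian integral. *)
Lemma gdot_hermite_gt0 n : 0 < gdot (hermite_poly n) (hermite_poly n).
Proof.
elim: n => [|n IH]; last first.
  by rewrite gdot_hermiteS deriv_hermiteS gdotZr mulr_gt0// ltr0n.
rewrite /gdot (_ : \int[mu]_t _ = Num.sqrt pi) ?sqrtr_gt0 ?pi_gt0//.
rewrite /Rintegral -[RHS](congr1 fine (@integralT_gauss R)).
congr fine; apply: eq_integral => t _; rewrite /gauss_fun /gpoly hornerC.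
by rewrite !mul1r -expRD; congr (expR _)%:E; field.
Qed.

(** Read off from the total mass 1 of the standard normal density. *)
Lemma int_gpoly1 : \int[mu]_t gpoly 1 t = Num.sqrt (2 * pi).
Proof.
have s0 : 0 < Num.sqrt (2 * pi) :> R by rewrite sqrtr_gt0 mulr_gt0 ?pi_gt0.
have E : @normal_pdf R 0 1 = fun t => (Num.sqrt (2 * pi))^-1 * gpoly 1 t.
  apply/funext => t.
  rewrite /normal_pdf oner_eq0 /normal_peak /normal_fun.
  rewrite /gpoly hornerC mul1r expr1n mul1r -mulr_natl subr0; congr (_ * expR _).
  by rewrite mulNr.
have := congr1 fine (@integral_normal_pdf R 0 1); rewrite E.
rewrite -/(Rintegral mu setT (fun t => (Num.sqrt (2 * pi))^-1 * gpoly 1 t)).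
rewrite RintegralZl//; last exact: L1_gpoly.
by move=> /(canRL (mulKf (lt0r_neq0 _))) -> //; rewrite /= ?invr_gt0 ?invrK ?mulr1.
Qed.

(** For real f, the real part of the Fourier integral before normalization; [sin_transform] is the
    imaginary part. *)
Definition cos_transform f t : R := \int[mu]_x (f x * cos (t * x)).
Definition sin_transform f t : R := \int[mu]_x (f x * sin (t * x)).

Lemma is_derive_cosM t x : is_derive t 1 (fun s : R => cos (s * x)) (- (x * sin (t * x))).
Proof.
have d1 : is_derive t 1 (fun s : R => s * x) x.
  by apply: is_derive_eq; rewrite /GRing.scale/=; ring.
have d := @is_derive1_comp _ (@cos R) (fun s => s * x) t _ _ (is_derive_cos (t * x)) d1.
by apply: (is_derive_eq d); rewrite /GRing.scale/=; ring.
Qed.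

Lemma is_derive_sinM t x : is_derive t 1 (fun s : R => sin (s * x)) (x * cos (t * x)).
Proof.
have d1 : is_derive t 1 (fun s : R => s * x) x.
  by apply: is_derive_eq; rewrite /GRing.scale/=; ring.
have d := @is_derive1_comp _ (@sin R) (fun s => s * x) t _ _ (is_derive_sin (t * x)) d1.
by apply: (is_derive_eq d); rewrite /GRing.scale/=; ring.
Qed.

Lemma is_derive_cosMl t x : is_derive x 1 (fun y : R => cos (t * y)) (- (t * sin (t * x))).
Proof.
have d := is_derive_cosM x t; move: d; rewrite [x * t]mulrC => d.
by under eq_fun do rewrite mulrC.
Qed.

Lemma is_derive_sinMl t x : is_derive x 1 (fun y : R => sin (t * y)) (t * cos (t * x)).
Proof.
have d := is_derive_sinM x t; move: d; rewrite [x * t]mulrC => d.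
by under eq_fun do rewrite mulrC.
Qed.

Lemma measurable_cosM t : measurable_fun [set: R] (fun x => cos (t * x)).
Proof.
apply: continuous_measurable_fun => x; apply: continuous_comp; last exact: continuous_cos.
exact: mulrl_continuous.
Qed.

Lemma measurable_sinM t : measurable_fun [set: R] (fun x => sin (t * x)).
Proof.
apply: continuous_measurable_fun => x; apply: continuous_comp; last exact: continuous_sin.
exact: mulrl_continuous.
Qed.

Lemma normr_cos_le1 x : `|cos x| <= 1.
Proof. by rewrite ler_norml cos_geN1 cos_le1. Qed.

Lemma normr_sin_le1 x : `|sin x| <= 1.
Proof. by rewrite ler_norml sin_geN1 sin_le1. Qed.

Lemma L1_Mcos f t : L1 f -> L1 (fun x => f x * cos (t * x)).
Proof.
move=> If; apply: (@L1_Mbounded _ _ _ 1) => //; first exact: measurable_cosM.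
by move=> x; exact: normr_cos_le1.
Qed.

Lemma L1_Msin f t : L1 f -> L1 (fun x => f x * sin (t * x)).
Proof.
move=> If; apply: (@L1_Mbounded _ _ _ 1) => //; first exact: measurable_sinM.
by move=> x; exact: normr_sin_le1.
Qed.

(** The kernel k is merely bounded, so the decay that removes the boundary terms comes from
    [gpoly p] alone. *)
Lemma gpoly_parts p (k k' : R -> R) : (forall x : R, is_derive x 1 k (k' x)) ->
  continuous k' -> (forall x, `|k x| <= 1) -> L1 (fun x => gpoly p x * k' x) ->
  \int[mu]_x (gpoly (p^`() - 'X * p) x * k x) = - (\int[mu]_x (gpoly p x * k' x)).
Proof.
move=> dk ck' k1 Ik'.
have ck : continuous k.
  move=> x; apply: differentiable_continuous; apply/derivable1_diffP.
  by have [] := dk x.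
have Ik : L1 (fun x => gpoly (p^`() - 'X * p) x * k x).
  by apply: (L1_Mbounded (L1_gpoly _) _ k1); exact: continuous_measurable_fun.
apply/eqP; rewrite -addr_eq0 -RintegralD//; apply/eqP.
apply: (@Rintegral_derive_eq0 (fun x => gpoly p x * k x)).
- move=> x; have d := is_deriveM (is_derive_gpoly p x) (dk x).
  by apply: (is_derive_eq d); rewrite /GRing.scale/=; ring.
- move=> x; apply: cvgD; apply: cvgM;
    [exact: continuous_gpoly|exact: ck|exact: continuous_gpoly|exact: ck'].
- exact: L1D.
- have [M pM] := gpoly_decay p; exists M => x.
  rewrite normrM mulrA -[leRHS]mulr1; apply: ler_pM => //.
  by rewrite mulr_ge0// addr_ge0 ?sqr_ge0.
Qed.

(** With [sin_transform_parts], the real and imaginary parts of F(f') = -i t F(f). *)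
Lemma cos_transform_parts p t :
  cos_transform (gpoly (p^`() - 'X * p)) t = t * sin_transform (gpoly p) t.
Proof.
have E x : gpoly p x * - (t * sin (t * x)) = - t * (gpoly p x * sin (t * x)) by ring.
rewrite /cos_transform (@gpoly_parts p _ _ (is_derive_cosMl t)).
- under eq_Rintegral do rewrite E.
  by rewrite RintegralZl ?mulNr ?opprK//; exact/L1_Msin/L1_gpoly.
- move=> x; apply: cvgN; apply: cvgM; first exact: cvg_cst.
  by apply: continuous_comp; [exact: mulrl_continuous|exact: continuous_sin].
- by move=> x; exact: normr_cos_le1.
- by under eq_fun do rewrite E; apply/L1Z/L1_Msin/L1_gpoly.
Qed.

Lemma sin_transform_parts p t :
  sin_transform (gpoly (p^`() - 'X * p)) t = - (t * cos_transform (gpoly p) t).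
Proof.
have E x : gpoly p x * (t * cos (t * x)) = t * (gpoly p x * cos (t * x)) by ring.
rewrite /sin_transform (@gpoly_parts p _ _ (is_derive_sinMl t)).
- under eq_Rintegral do rewrite E.
  by rewrite RintegralZl//; exact/L1_Mcos/L1_gpoly.
- move=> x; apply: cvgM; first exact: cvg_cst.
  by apply: continuous_comp; [exact: mulrl_continuous|exact: continuous_cos].
- by move=> x; exact: normr_sin_le1.
- by under eq_fun do rewrite E; apply/L1Z/L1_Mcos/L1_gpoly.
Qed.

Lemma is_derive_Rintegral (k k' : R -> R -> R) f t :
  (forall s, L1 (fun x => k s x)) ->
  (forall s x : R, is_derive s 1 (k ^~ x) (k' s x)) ->
  L1 f -> (forall s x, `|k' s x| <= f x) ->
  is_derive t 1 (fun s => \int[mu]_x k s x) (\int[mu]_x k' t x).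
Proof.
move=> Ik dk If k'f.
(* Any neighbourhood of t would do, the bound on [k'] being global. *)
have tI : `]t - 1, t + 1[%classic t by rewrite /= in_itv/=; lra.
have dE s x : partial1of2 k s x = k' s x.
  by rewrite partial1of2E; have [] := dk s x.
have f0 x : 0 <= f x by apply: le_trans (k'f 0 x).
have h1 : forall s, `]t - 1, t + 1[%classic s -> mu.-integrable setT (EFin \o k s).
  by move=> s _; exact: Ik.
have h2 : forall s x, `]t - 1, t + 1[%classic s -> [set: R] x -> derivable (k ^~ x) s 1.
  by move=> s x _ _; have [] := dk s x.
have h3 : forall s x, `]t - 1, t + 1[%classic s -> [set: R] x -> `|partial1of2 k s x| <= f x.
  by move=> s x _ _; rewrite dE.
have D := derivable_under_integral measurableT tI h1 h2 f0 If h3.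
have DE := differentiation_under_integral measurableT tI h1 h2 f0 If h3.
split; first exact: D.
rewrite -derive1E DE.
by apply: eq_Rintegral => x _; rewrite dE.
Qed.

(** With [is_derive_sin_transform], the real and imaginary parts of F(f)' = i F(x f). *)
Lemma is_derive_cos_transform p t :
  is_derive t 1 (cos_transform (gpoly p)) (- sin_transform (gpoly ('X * p)) t).
Proof.
rewrite /sin_transform.
have E x : - (gpoly ('X * p) x * sin (t * x)) = gpoly p x * - (x * sin (t * x)).
  by rewrite gpolyXM; ring.
have -> : - (\int[mu]_x (gpoly ('X * p) x * sin (t * x))) =
    \int[mu]_x (gpoly p x * - (x * sin (t * x))).
  rewrite -mulN1r -RintegralZl//; last exact/L1_Msin/L1_gpoly.
  by apply: eq_Rintegral => x _; rewrite mulN1r E.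
apply: (@is_derive_Rintegral _ (fun s x => gpoly p x * - (x * sin (s * x)))
  (fun x => `|gpoly ('X * p) x|)).
- by move=> s; exact/L1_Mcos/L1_gpoly.
- move=> s x; have d := is_deriveM (is_derive_cst (gpoly p x) s 1) (is_derive_cosM s x).
  by apply: (is_derive_eq d); rewrite /GRing.scale/=; ring.
- exact/L1_norm/L1_gpoly.
- move=> s x; rewrite mulrN normrN mulrA normrM gpolyXM [x * _]mulrC ler_piMr//.
  exact: normr_sin_le1.
Qed.

Lemma is_derive_sin_transform p t :
  is_derive t 1 (sin_transform (gpoly p)) (cos_transform (gpoly ('X * p)) t).
Proof.
have -> : cos_transform (gpoly ('X * p)) t =
    \int[mu]_x (gpoly p x * (x * cos (t * x))).
  by apply: eq_Rintegral => x _; rewrite gpolyXM; ring.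
apply: (@is_derive_Rintegral _ (fun s x => gpoly p x * (x * cos (s * x)))
  (fun x => `|gpoly ('X * p) x|)).
- by move=> s; exact/L1_Msin/L1_gpoly.
- move=> s x; have d := is_deriveM (is_derive_cst (gpoly p x) s 1) (is_derive_sinM s x).
  by apply: (is_derive_eq d); rewrite /GRing.scale/=; ring.
- exact/L1_norm/L1_gpoly.
- move=> s x; rewrite mulrA normrM gpolyXM [x * _]mulrC ler_piMr//.
  exact: normr_cos_le1.
Qed.

(** The product of F with e^(t^2/2) has derivative zero. *)
Lemma gauss_ode (F : R -> R) : (forall t : R, is_derive t 1 F (- (t * F t))) ->
  forall t, F t = F 0 * gpoly 1 t.
Proof.
move=> dF t.
have d1 (s : R) : is_derive s 1 (fun t : R => t ^+ 2 / 2) s.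
  by apply: is_derive_eq; rewrite /GRing.scale/=; field.
have d (s : R) : is_derive s 1 (fun u => F u * expR (u ^+ 2 / 2)) 0.
  have d2 := is_deriveM (dF s) (is_derive1_comp (is_derive_expR _) (d1 s)).
  by apply: (is_derive_eq d2); rewrite /GRing.scale/=; ring.
have := @is_derive_0_is_cst R (fun u => F u * expR (u ^+ 2 / 2)) t 0 d.
rewrite expr0n mul0r expR0 mulr1 => <-.
by rewrite /gpoly hornerC mul1r -mulrA -expRD subrr expR0 mulr1.
Qed.

Lemma cos_transformB p q t :
  cos_transform (gpoly (p - q)) t = cos_transform (gpoly p) t - cos_transform (gpoly q) t.
Proof.
rewrite /cos_transform -RintegralB//; try exact/L1_Mcos/L1_gpoly.
by apply: eq_Rintegral => x _; rewrite gpolyB mulrBl.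
Qed.

Lemma sin_transformB p q t :
  sin_transform (gpoly (p - q)) t = sin_transform (gpoly p) t - sin_transform (gpoly q) t.
Proof.
rewrite /sin_transform -RintegralB//; try exact/L1_Msin/L1_gpoly.
by apply: eq_Rintegral => x _; rewrite gpolyB mulrBl.
Qed.

Lemma is_deriveZl (a : R) f (df t : R) : is_derive t 1 f df ->
  is_derive t 1 (fun s => a * f s) (a * df).
Proof. by move=> d; have := is_deriveZ a d. Qed.

Lemma is_derive_unique f (a b t : R) :
  is_derive t 1 f a -> is_derive t 1 f b -> a = b.
Proof. by move=> [_ <-] [_ <-]. Qed.

(** The transform exchanges t and d/dt up to factors of i, so that F (t - d/dt) = i (t - d/dt) F and
    each creation step contributes one factor i. It is written in real and imaginary parts. *)
Lemma hermite_transforms n t :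
  cos_transform (gpoly (hermite_poly n)) t =
    Num.sqrt (2 * pi) * complex.Re ((0 +i* 1) ^+ n : R[i]) * gpoly (hermite_poly n) t /\
  sin_transform (gpoly (hermite_poly n)) t =
    Num.sqrt (2 * pi) * complex.Im ((0 +i* 1) ^+ n : R[i]) * gpoly (hermite_poly n) t.
Proof.
elim: n t => [|n IH] t.
  (* The Gaussian satisfies t e^(-t^2/2) = - (e^(-t^2/2))'. Both of its transforms therefore solve
     y' = - t y and are fixed by their values at 0, namely sqrt(2 pi) and 0. *)
  have X1 : 'X * 1 = 0 - ((1 : {poly R})^`() - 'X * 1) by rewrite derivC !sub0r opprK.
  have p0 : (0 : {poly R}) = 0 - 0 by rewrite subr0.
  have C0 s : cos_transform (gpoly 0) s = 0 by rewrite p0 cos_transformB subrr.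
  have S0 s : sin_transform (gpoly 0) s = 0 by rewrite p0 sin_transformB subrr.
  rewrite expr0 /= mulr1 mulr0 mul0r; split.
    have dC (s : R) : is_derive s 1 (cos_transform (gpoly 1))
        (- (s * cos_transform (gpoly 1) s)).
      apply: (is_derive_eq (is_derive_cos_transform 1 s)).
      by rewrite X1 sin_transformB S0 sin_transform_parts; ring.
    rewrite (gauss_ode dC) -int_gpoly1; congr (_ * _); apply: eq_Rintegral => x _.
    by rewrite mul0r cos0 mulr1.
  have dS (s : R) : is_derive s 1 (sin_transform (gpoly 1))
      (- (s * sin_transform (gpoly 1) s)).
    apply: (is_derive_eq (is_derive_sin_transform 1 s)).
    by rewrite X1 cos_transformB C0 cos_transform_parts; ring.
  rewrite (gauss_ode dS) [X in X * _](_ : _ = 0) ?mul0r// /sin_transform.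
  under eq_Rintegral do rewrite mul0r sin0 mulr0.
  by rewrite Rintegral_cst// mul0r.
set p := hermite_poly n; set i := 0 +i* 1; set s2 := Num.sqrt _.
have [ReS ImS] : complex.Re (i ^+ n.+1) = - complex.Im (i ^+ n) /\
    complex.Im (i ^+ n.+1) = complex.Re (i ^+ n).
  by rewrite exprS; case: (i ^+ n) => a b; rewrite /i /=; split; ring.
have CE : cos_transform (gpoly p) = fun s => s2 * complex.Re (i ^+ n) * gpoly p s.
  by apply/funext => s; have [] := IH s.
have SE : sin_transform (gpoly p) = fun s => s2 * complex.Im (i ^+ n) * gpoly p s.
  by apply/funext => s; have [] := IH s.
have -> : hermite_poly n.+1 = 'X * p - (p^`() - 'X * p).
  by rewrite /= -/p (_ : 2 *: _ = 'X * p + 'X * p) ?opprB ?addrA// -mulr2n scaler_nat.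
(* The transform of t h_n is the derivative of a transform of h_n, which the induction hypothesis
   gives explicitly. Uniqueness of the derivative identifies the two expressions. *)
have CX : cos_transform (gpoly ('X * p)) t =
    s2 * complex.Im (i ^+ n) * gpoly (p^`() - 'X * p) t.
  apply: is_derive_unique (is_derive_sin_transform p t) _.
  by rewrite SE; apply: is_deriveZl; exact: is_derive_gpoly.
have SX : - sin_transform (gpoly ('X * p)) t =
    s2 * complex.Re (i ^+ n) * gpoly (p^`() - 'X * p) t.
  apply: is_derive_unique (is_derive_cos_transform p t) _.
  by rewrite CE; apply: is_deriveZl; exact: is_derive_gpoly.
rewrite cos_transformB sin_transformB cos_transform_parts sin_transform_parts.
rewrite CX -[sin_transform (gpoly ('X * p)) t]opprK SX CE SE ReS ImS !gpolyB gpolyXM.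
by split; ring.
Qed.

Lemma fourier_integral_real f :
  fourier_integral (fun t => (f t)%:C) =
  fun t => (Num.sqrt (2 * pi))^-1%:C * (cos_transform f t +i* sin_transform f t).
Proof.
apply/funext => t; rewrite /fourier_integral /cintegral.
congr (_ * (_ +i* _)); apply: eq_Rintegral => x _; rewrite /reF /imF /=.
  by rewrite mul0r subr0.
by rewrite mul0r addr0.
Qed.

Lemma fourier_integral_hermite n :
  fourier_integral (@hermite_fun R n) = fun t => (0 +i* 1) ^+ n * hermite_fun n t.
Proof.
rewrite hermite_funE fourier_integral_real.
apply/funext => t; have [-> ->] := hermite_transforms n t.
have s0 : Num.sqrt (2 * pi) != 0 :> R by rewrite gt_eqF// sqrtr_gt0 mulr_gt0 ?pi_gt0.
case: ((0 +i* 1) ^+ n) => a b; apply/eqP; rewrite eq_complex/=.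
by apply/andP; split; apply/eqP; field.
Qed.

End HermiteFunctions.

(** * The Hilbert space L2 *)

Section RieszFischer.
Context {R : realType}.
Local Notation mu := (@lebesgue_measure R).
Local Notation L1 f := (mu.-integrable [set: R] (EFin \o f)).

Lemma bounded_variation_cvgn (x : nat -> R) (M : R) :
  (forall n, \sum_(0 <= k < n) `|x k.+1 - x k| <= M) -> cvgn x.
Proof.
move=> xM.
have : cvgn (series (fun n => x n.+1 - x n)).
  apply: normed_cvg; apply: nondecreasing_is_cvgn.
    by apply: nondecreasing_series => n _ _ /=.
  by exists M => _ [n _ <-]; exact: xM.
move=> /cvg_ex[l xl]; apply/cvg_ex; exists (l + x 0%N).
have : (series (fun n => x n.+1 - x n) \+ cst (x 0%N)) n @[n --> \oo] --> l + x 0%N.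
  by apply: cvgD => //; exact: cvg_cst.
rewrite (_ : _ \+ _ = x)//.
by apply/funext => n; rewrite /series/= telescope_sumr// subrK.
Qed.

Lemma geometric_half_sum_le (n : nat) : \sum_(0 <= k < n) 2^-1 ^+ k <= 2 :> R.
Proof.
suff -> : \sum_(0 <= k < n) 2^-1 ^+ k = 2 - 2 * 2^-1 ^+ n :> R.
  by rewrite gerBl mulr_ge0// exprn_ge0.
elim: n => [|n IH]; first by rewrite big_nil expr0 mulr1 subrr.
by rewrite big_nat_recr//= IH exprS; field.
Qed.

(** Weighting the squared increments by 2^n still leaves a series of integrals bounded by the sum of
    2^n 4^(-n), which is at most 2. The weighted series is thus finite almost everywhere, and where
    it is finite it controls the total variation of the sequence. *)
Lemma L2_fast_cauchy_ae (u : nat -> R -> R) :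
  (forall n, measurable_fun [set: R] (u n)) ->
  (forall n, (\int[mu]_t ((u n.+1 t - u n t) ^+ 2)%:E <= (4^-1 ^+ n)%:E)%E) ->
  exists2 f : R -> R, measurable_fun [set: R] f &
    {ae mu, forall t, u n t @[n --> \oo] --> f t}.
Proof.
move=> um ud.
have mu2 n : measurable_fun [set: R] (fun t => ((u n.+1 t - u n t) ^+ 2)%:E).
  by apply/measurable_EFinP; apply: measurable_funX; exact: measurable_funB.
pose d n t : \bar R := (2 ^+ n * (u n.+1 t - u n t) ^+ 2)%:E.
have md n : measurable_fun [set: R] (d n).
  apply/measurable_EFinP; apply: measurable_funM => //.
  by apply: measurable_funX; exact: measurable_funB.
have d0 n t : (0 <= d n t)%E by rewrite lee_fin mulr_ge0 ?sqr_ge0 ?exprn_ge0.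
pose D t : \bar R := (\sum_(n <oo) d n t)%E.
have mD : measurable_fun [set: R] D by exact: ge0_emeasurable_sum.
have D0 t : (0 <= D t)%E by exact: nneseries_ge0.
have ID : (\int[mu]_t D t < +oo)%E.
  rewrite integral_nneseries//.
  apply: (@le_lt_trans _ _ (\sum_(n <oo) (2^-1 ^+ n)%:E)%E).
    apply: lee_nneseries => n; first by move=> *; exact: integral_ge0.
    move=> _.
    rewrite /d; under eq_integral do rewrite EFinM.
    rewrite ge0_integralZl//.
    - apply: (@le_trans _ _ ((2 ^+ n)%:E * (4^-1 ^+ n)%:E)%E).
        by rewrite lee_pmul2l// lte_fin exprn_gt0.
      by rewrite -EFinM -exprMn lee_fin (_ : 2 / 4 = 2^-1)//; field.
    - exact: mu2.
    - by move=> t _; rewrite lee_fin sqr_ge0.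
  apply: (@le_lt_trans _ _ 2%:E); last exact: ltry.
  apply: lime_le.
    by apply: is_cvg_nneseries => n _ _; rewrite lee_fin exprn_ge0.
  by apply: nearW => n; rewrite sumEFin lee_fin geometric_half_sum_le.
pose E := [set t | (D t < +oo)%E].
have mE : measurable E.
  rewrite (_ : E = [set: R] `&` [set t | (D t < (cst +oo) t)%E]); last by rewrite setTI.
  by apply: emeasurable_fun_lt => //; exact: measurable_cst.
have cE t : E t -> cvgn (u ^~ t).
  rewrite /E/= => Dt.
  apply: (@bounded_variation_cvgn _ (2 + fine (D t))) => n.
  have dn : \sum_(0 <= k < n) 2 ^+ k * (u k.+1 t - u k t) ^+ 2 <= fine (D t).
    rewrite -lee_fin fineK ?ge0_fin_numE// -sumEFin.
    by apply: nneseries_lim_ge => k _ _; exact: (d0 k t).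
  apply: le_trans (lerD (geometric_half_sum_le n) dn).
  rewrite -big_split/=; apply: ler_sum => k _.
  have k2 : 0 < 2 ^+ k :> R by exact: exprn_gt0.
  (* AM-GM: [x <= 2 ^- k + 2 ^+ k * x ^+ 2] *)
  rewrite exprVn -real_normK ?num_real//; set x := `|_|; set y := 2 ^+ k in k2 *.
  rewrite -(@ler_pM2l _ y)// mulrDr divff ?gt_eqF//.
  by have := sqr_ge0 (y * x - 1); nra.
(* Cutting off outside E makes the sequence converge at every point, so its pointwise limit is
   measurable. *)
pose v n t := u n t * \1_E t.
have mv n : measurable_fun [set: R] (v n) by apply: measurable_funM.
have cv t : cvgn (v ^~ t).
  rewrite /v; have [tE|tE] := pselect (E t).
    by rewrite indicE mem_set//; apply: is_cvgM; [exact: cE|exact: is_cvg_cst].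
  by rewrite indicE memNset//; under eq_fun do rewrite mulr0; exact: is_cvg_cst.
exists (fun t => limn (v ^~ t)).
  by apply: (measurable_fun_cvg mv) => t _; exact: cv.
have iD : mu.-integrable [set: R] D.
  apply/integrableP; split => //.
  by under eq_integral => t _ do rewrite gee0_abs//.
have := integrable_ae measurableT iD.
apply: (@filterS _ _ (ae_filter_ringOfSetsType mu)) => t /(_ I).
rewrite ge0_fin_numE// => tE.
rewrite (_ : u ^~ t = v ^~ t); first exact: cv.
by apply/funext => n; rewrite /v indicE mem_set// mulr1.
Qed.

End RieszFischer.

(** * Integration of complex-valued functions *)

Section ComplexIntegral.
Context {R : realType}.
Implicit Types (f g h : R -> R[i]) (a : R[i]).
Local Notation mu := (@lebesgue_measure R).
Local Notation L1 f := (mu.-integrable [set: R] (EFin \o f)).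

Definition cintegrable f := L1 (reF f) /\ L1 (imF f).

Lemma cmeasurable_integrable f : cintegrable f -> cmeasurable f.
Proof. by move=> [/L1_measurable ? /L1_measurable ?]. Qed.

Lemma cintegrableD f g : cintegrable f -> cintegrable g ->
  cintegrable (fun t => f t + g t).
Proof.
move=> [rf jf] [rg jg]; split; [apply: L1_eq (L1D rf rg)|apply: L1_eq (L1D jf jg)];
  by move=> t; rewrite /reF /imF raddfD.
Qed.

Lemma cintegralD f g : cintegrable f -> cintegrable g ->
  cintegral (fun t => f t + g t) = cintegral f + cintegral g.
Proof.
move=> [rf jf] [rg jg]; apply/eqP; rewrite eq_complex/= -!RintegralD//.
by apply/andP; split; apply/eqP; apply: eq_Rintegral => t _; rewrite /reF /imF raddfD.
Qed.

Lemma cintegrableZ a f : cintegrable f -> cintegrable (fun t => a * f t).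
Proof.
move=> [rf jf]; split.
  apply: L1_eq (L1B (L1Z (complex.Re a) rf) (L1Z (complex.Im a) jf)) => t.
  by rewrite /reF /imF; case: a (f t) => [? ?] [? ?].
apply: L1_eq (L1D (L1Z (complex.Re a) jf) (L1Z (complex.Im a) rf)) => t.
by rewrite /reF /imF; case: a (f t) => [? ?] [? ?].
Qed.

Lemma cintegralZ a f : cintegrable f ->
  cintegral (fun t => a * f t) = a * cintegral f.
Proof.
move=> [rf jf]; case: a => x y.
have [? [? [? ?]]] := (L1Z x rf, (L1Z y jf, (L1Z x jf, L1Z y rf))).
apply/eqP; rewrite eq_complex/= -!RintegralZl// -RintegralB// -RintegralD//.
by apply/andP; split; apply/eqP; apply: eq_Rintegral => t _;
  rewrite /reF /imF; case: (f t).
Qed.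

Lemma cintegral_conj f : cintegrable f ->
  cintegral (fun t => conjc (f t)) = conjc (cintegral f).
Proof.
move=> [rf jf]; apply/eqP; rewrite eq_complex/=; apply/andP; split; apply/eqP.
  by apply: eq_Rintegral => t _; rewrite /reF; case: (f t).
rewrite -mulN1r -RintegralZl//.
by apply: eq_Rintegral => t _; rewrite /imF mulN1r; case: (f t).
Qed.

Lemma ae_eq_cintegral f g : cmeasurable f -> cmeasurable g ->
  {ae mu, forall t, f t = g t} -> cintegral f = cintegral g.
Proof.
move=> [mrf mif] [mrg mig] fg; rewrite /cintegral /Rintegral.
congr (fine _ +i* fine _); apply: ae_eq_integral => //; try exact/measurable_EFinP.
  by apply: (@filterS _ _ (ae_filter_ringOfSetsType mu) _ _ _ fg) => t ft _;
    rewrite /= /reF ft.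
by apply: (@filterS _ _ (ae_filter_ringOfSetsType mu) _ _ _ fg) => t ft _;
  rewrite /= /imF ft.
Qed.

Lemma square_integrableP f :
  square_integrable f <-> cmeasurable f /\ L1 (fun t => cmod2 (f t)).
Proof.
split=> [[mf If]|[mf /integrableP[_ If]]]; split => //; last first.
  move: If; under eq_integral => t _ do rewrite /= ger0_norm ?cmod2_ge0//.
  by [].
apply/integrableP; split; first exact: measurable_cmod2.
by under eq_integral => t _ do rewrite /= ger0_norm ?cmod2_ge0//.
Qed.

Lemma cmod2_conj (z : R[i]) : cmod2 (conjc z) = cmod2 z.
Proof. by case: z => x y; rewrite /cmod2/= sqrrN. Qed.

Lemma cmeasurableM f g : cmeasurable f -> cmeasurable g ->
  cmeasurable (fun t => f t * g t).
Proof.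
move=> [mrf mif] [mrg mig]; split.
  rewrite (_ : reF _ = fun t => reF f t * reF g t - imF f t * imF g t).
    by apply: measurable_funB; exact: measurable_funM.
  by apply/funext => t; rewrite /reF /imF; case: (f t) (g t) => [? ?] [? ?].
rewrite (_ : imF _ = fun t => reF f t * imF g t + imF f t * reF g t).
  by apply: measurable_funD; exact: measurable_funM.
by apply/funext => t; rewrite /reF /imF; case: (f t) (g t) => [? ?] [? ?].
Qed.

Lemma cmeasurable_conj f : cmeasurable f -> cmeasurable (fun t => conjc (f t)).
Proof.
move=> [mrf mif]; split.
  by rewrite (_ : reF _ = reF f)//; apply/funext => t; rewrite /reF; case: (f t).
rewrite (_ : imF _ = fun t => - imF f t); first exact: measurableT_comp.
by apply/funext => t; rewrite /imF; case: (f t).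
Qed.

Lemma normr_ReM_le (z w : R[i]) : `|complex.Re (z * w)| <= cmod2 z + cmod2 w.
Proof.
case: z w => [a b] [c d]; rewrite /cmod2/= ler_norml.
have := sqr_ge0 (a - c); have := sqr_ge0 (a + c).
have := sqr_ge0 (b - d); have := sqr_ge0 (b + d).
by move=> *; apply/andP; split; nra.
Qed.

Lemma normr_ImM_le (z w : R[i]) : `|complex.Im (z * w)| <= cmod2 z + cmod2 w.
Proof.
case: z w => [a b] [c d]; rewrite /cmod2/= ler_norml.
have := sqr_ge0 (a - d); have := sqr_ge0 (a + d).
have := sqr_ge0 (b - c); have := sqr_ge0 (b + c).
by move=> *; apply/andP; split; nra.
Qed.

Lemma cintegrableM f g : square_integrable f -> square_integrable g ->
  cintegrable (fun t => f t * g t).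
Proof.
move=> /square_integrableP[mf If] /square_integrableP[mg Ig].
have [mr mi] := cmeasurableM mf mg.
split; apply: (L1_le _ _ (L1D If Ig)) => // t.
  exact: normr_ReM_le.
exact: normr_ImM_le.
Qed.

Lemma square_integrable_conj f : square_integrable f ->
  square_integrable (fun t => conjc (f t)).
Proof.
move=> /square_integrableP[mf If]; apply/square_integrableP; split.
  exact: cmeasurable_conj.
by apply: L1_eq If => t; rewrite cmod2_conj.
Qed.

End ComplexIntegral.

(** * Classes modulo null sets and their representatives *)

Section L2Representatives.
Context {R : realType}.
Implicit Types (f g h : R -> R[i]) (u v w : L2 R) (a : R[i]).
Local Notation mu := (@lebesgue_measure R).
Local Notation L1 f := (mu.-integrable [set: R] (EFin \o f)).

Lemma L2fun_square_integrable (f : L2fun R) : square_integrable f.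
Proof. exact/asboolP/(L2valP f). Qed.

Lemma repr_square_integrable u : square_integrable (repr u).
Proof. exact: L2fun_square_integrable. Qed.

Lemma piL2_eq (f g : L2fun R) :
  \pi_(L2 R) f = \pi_(L2 R) g <-> {ae mu, forall t, f t = g t}.
Proof.
have E : (\pi_(L2 R) f == \pi_(L2 R) g) = ((f - g) \in @ae_null R).
  by rewrite -Quotient.idealrBE.
split=> [/eqP|fg].
  rewrite E => /asboolP; apply: (@filterS _ _ (ae_filter_ringOfSetsType mu)) => t.
  by rewrite /= !fctE => /eqP; rewrite subr_eq0 => /eqP.
apply/eqP; rewrite E; apply/asboolP.
apply: (@filterS _ _ (ae_filter_ringOfSetsType mu) _ _ _ fg) => t ft.
by rewrite /= !fctE ft subrr.
Qed.

Lemma toL2E (f : L2fun R) : toL2 f = \pi_(L2 R) f.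
Proof. by rewrite /toL2 valKd. Qed.

Lemma toL2_repr u : toL2 (repr u) = u.
Proof. by rewrite toL2E; exact: (@reprK _ (L2 R)). Qed.

(** The representative returned by [repr] is arbitrary within its class, so computations with
    classes pass through almost-everywhere identities of this kind. *)
Lemma repr_toL2_ae f : square_integrable f ->
  {ae mu, forall t, repr (toL2 f) t = f t}.
Proof.
move=> sf; have fL : f \in @L2pred R by apply/asboolP.
rewrite (_ : f = MkL2fun fL)// toL2E.
by apply/piL2_eq; exact: (@reprK _ (L2 R)).
Qed.

Lemma eq_ae_repr u v : {ae mu, forall t, repr u t = repr v t} -> u = v.
Proof. by move=> uv; rewrite -(toL2_repr u) -(toL2_repr v) !toL2E; apply/piL2_eq. Qed.

Lemma toL2_ae_eq f g : square_integrable f -> square_integrable g ->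
  {ae mu, forall t, f t = g t} -> toL2 f = toL2 g.
Proof.
move=> sf sg fg; apply: eq_ae_repr.
have := repr_toL2_ae sf; have := repr_toL2_ae sg.
apply: (@filterS3 _ _ (ae_filter_ringOfSetsType mu) _ _ _ _ _ fg) => t.
by move=> ft -> ->.
Qed.

Lemma reprD_ae u v : {ae mu, forall t, repr (u + v) t = repr u t + repr v t}.
Proof.
apply/(piL2_eq (repr (u + v)) (repr u + repr v)).
rewrite -piL2D -!toL2E !toL2_repr //.
Qed.

Lemma reprZ_ae a u : {ae mu, forall t, repr (a *: u) t = a * repr u t}.
Proof.
apply/(piL2_eq (repr (a *: u)) (a *: repr u)).
by rewrite -!toL2E toL2_repr toL2E.
Qed.

Lemma repr0_ae : {ae mu, forall t, repr (0 : L2 R) t = 0}.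
Proof.
have := reprZ_ae 0 0; rewrite scale0r.
by apply: (@filterS _ _ (ae_filter_ringOfSetsType mu)) => t ->; rewrite mul0r.
Qed.

Let mrepr u : cmeasurable (repr u).
Proof. by have [] := repr_square_integrable u. Qed.

Let crepr u v : cintegrable (fun t => repr u t * conjc (repr v t)).
Proof.
apply: cintegrableM; first exact: repr_square_integrable.
by apply: square_integrable_conj; exact: repr_square_integrable.
Qed.

Lemma inner_toL2r u f : square_integrable f ->
  inner u (toL2 f) = cintegral (fun t => repr u t * conjc (f t)).
Proof.
move=> sf; apply: ae_eq_cintegral.
- exact/cmeasurable_integrable/crepr.
- by apply: cmeasurableM => //; apply: cmeasurable_conj; case: sf.
- apply: (@filterS _ _ (ae_filter_ringOfSetsType mu) _ _ _ (repr_toL2_ae sf)).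
  by move=> t ->.
Qed.

Lemma innerDl u v w : inner (u + v) w = inner u w + inner v w.
Proof.
rewrite /inner -cintegralD//; apply: ae_eq_cintegral.
- exact/cmeasurable_integrable/crepr.
- by apply: cmeasurable_integrable; apply: cintegrableD.
- apply: (@filterS _ _ (ae_filter_ringOfSetsType mu) _ _ _ (reprD_ae u v)).
  by move=> t ->; rewrite mulrDl.
Qed.

Lemma innerZl a u v : inner (a *: u) v = a * inner u v.
Proof.
rewrite /inner -cintegralZ//; apply: ae_eq_cintegral.
- exact/cmeasurable_integrable/crepr.
- by apply: cmeasurable_integrable; apply: cintegrableZ.
- apply: (@filterS _ _ (ae_filter_ringOfSetsType mu) _ _ _ (reprZ_ae a u)).
  by move=> t ->; rewrite mulrA.
Qed.

Lemma inner_conj u v : conjc (inner u v) = inner v u.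
Proof.
rewrite /inner -cintegral_conj//; congr cintegral; apply/funext => t.
case: (repr u t) (repr v t) => [a b] [c d]; apply/eqP; rewrite eq_complex/=.
by apply/andP; split; apply/eqP; ring.
Qed.

(** Pythagoras, Bessel and Parseval are identities or bounds on squared norms, so square roots enter
    only through [L2normE]. *)
Definition normsq u : R := \int[mu]_t cmod2 (repr u t).

Lemma inner_diag u : inner u u = (normsq u)%:C.
Proof.
apply/eqP; rewrite eq_complex/=; apply/andP; split; apply/eqP.
  apply: eq_Rintegral => t _; rewrite /reF /cmod2; case: (repr u t) => a b /=.
  by rewrite mulrN opprK.
have E t : imF (fun t => repr u t * conjc (repr u t)) t = 0.
  by rewrite /imF; case: (repr u t) => a b /=; ring.
under eq_Rintegral do rewrite E.
by rewrite Rintegral_cst// mul0r.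
Qed.

Lemma normsq_ge0 u : 0 <= normsq u.
Proof. by apply: Rintegral_ge0 => t _; exact: cmod2_ge0. Qed.

Lemma L2normE u : L2norm u = Num.sqrt (normsq u).
Proof. by rewrite /L2norm inner_diag. Qed.

Lemma L1_cmod2_repr u : L1 (fun t => cmod2 (repr u t)).
Proof. by have /square_integrableP[] := repr_square_integrable u. Qed.

Lemma cmod2_eq0 (z : R[i]) : cmod2 z = 0 -> z = 0.
Proof.
case: z => a b; rewrite /cmod2/= => /eqP; rewrite paddr_eq0 ?sqr_ge0// !sqrf_eq0.
by move=> /andP[/eqP -> /eqP ->].
Qed.

Lemma normsq_eq0 u : normsq u = 0 -> u = 0.
Proof.
move=> u0; apply: eq_ae_repr.
have /measurable_EFinP mu2 := L1_measurable (L1_cmod2_repr u).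
have : (\int[mu]_t `|(cmod2 (repr u t))%:E|)%E = 0%E.
  under eq_integral => t _ do rewrite /= ger0_norm ?cmod2_ge0//.
  move: u0; rewrite /normsq /Rintegral => /eqP.
  rewrite fine_eq0; first by move/eqP.
  exact: (integrable_fin_num measurableT (L1_cmod2_repr u)).
move/(ae_eq_integral_abs mu measurableT mu2).
apply: (@filterS2 _ _ (ae_filter_ringOfSetsType mu) _ _ _ _ repr0_ae) => t -> /(_ I) [].
exact: cmod2_eq0.
Qed.

End L2Representatives.

(** * Hilbert space geometry and completeness of L2 *)

Section HilbertSpace.
Context {R : realType}.
Implicit Types (u v w : L2 R) (a b : R[i]).
Local Notation mu := (@lebesgue_measure R).
Local Notation L1 f := (mu.-integrable [set: R] (EFin \o f)).

Lemma conjcD a b : conjc (a + b) = conjc a + conjc b.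
Proof. by case: a b => [? ?] [? ?] /=; rewrite opprD. Qed.

Lemma conjcN a : conjc (- a) = - conjc a.
Proof. by case: a. Qed.

Lemma conjcM a b : conjc (a * b) = conjc a * conjc b.
Proof.
case: a b => [? ?] [? ?]; apply/eqP; rewrite eq_complex/=.
by apply/andP; split; apply/eqP; ring.
Qed.

Lemma inner0l v : inner 0 v = 0.
Proof. by rewrite -(scale0r (0 : L2 R)) innerZl mul0r. Qed.

Lemma inner0r v : inner v 0 = 0.
Proof. by rewrite -inner_conj inner0l conjc0. Qed.

Lemma innerDr u v w : inner u (v + w) = inner u v + inner u w.
Proof. by rewrite -inner_conj innerDl conjcD !inner_conj. Qed.

Lemma innerZr a u v : inner u (a *: v) = conjc a * inner u v.
Proof. by rewrite -inner_conj innerZl conjcM inner_conj. Qed.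

Lemma innerNl u v : inner (- u) v = - inner u v.
Proof. by rewrite -scaleN1r innerZl mulN1r. Qed.

Lemma innerNr u v : inner u (- v) = - inner u v.
Proof. by rewrite -inner_conj innerNl conjcN inner_conj. Qed.

Lemma innerBl u v w : inner (u - v) w = inner u w - inner v w.
Proof. by rewrite innerDl innerNl. Qed.

Lemma inner_suml n (F : 'I_n -> L2 R) v :
  inner (\sum_k F k) v = \sum_k inner (F k) v.
Proof.
elim: n F => [|n IH] F; first by rewrite !big_ord0 inner0l.
by rewrite !big_ord_recl innerDl IH.
Qed.

Lemma normsqE u : normsq u = complex.Re (inner u u).
Proof. by rewrite inner_diag. Qed.

Lemma normsq0 : normsq (0 : L2 R) = 0.
Proof. by rewrite normsqE inner0l. Qed.

Lemma normsqD u v :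
  normsq (u + v) = normsq u + normsq v + 2 * complex.Re (inner u v).
Proof.
rewrite !normsqE innerDl !innerDr -(inner_conj u v).
by case: (inner u u) (inner v v) (inner u v) => [? ?] [? ?] [? ?] /=; ring.
Qed.

Lemma normsqZ a u : normsq (a *: u) = cmod2 a * normsq u.
Proof.
rewrite normsqE innerZl innerZr inner_diag; case: a => x y; rewrite /cmod2/=; ring.
Qed.

Lemma normsqN u : normsq (- u) = normsq u.
Proof. by rewrite -scaleN1r normsqZ /cmod2/= sqrrN expr1n oppr0 expr0n addr0 mul1r. Qed.

Lemma normsqB u v :
  normsq (u - v) = normsq u + normsq v - 2 * complex.Re (inner u v).
Proof. by rewrite normsqD normsqN innerNr; case: (inner u v) => ? ? /=; ring. Qed.

(** A consequence of the parallelogram law; it does the work of the triangle inequality for squared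
    norms. *)
Lemma normsqD_le u v : normsq (u + v) <= 2 * normsq u + 2 * normsq v.
Proof.
have := normsq_ge0 (u - v); rewrite normsqB normsqD.
by set c := complex.Re _; lra.
Qed.

Lemma cauchy_schwarz u v : cmod2 (inner u v) <= normsq u * normsq v.
Proof.
have [v0|v0] := eqVneq (normsq v) 0.
  by rewrite v0 mulr0 (normsq_eq0 v0) inner0r /cmod2/= expr0n addr0.
have vp : 0 < normsq v by rewrite lt_neqAle eq_sym v0 normsq_ge0.
(* The coefficient of the orthogonal projection of u on v; the inequality is nonnegativity of the
   squared norm of u - a v. *)
pose a : R[i] := (normsq v)^-1%:C * inner u v.
have := normsq_ge0 (u - a *: v); rewrite normsqB normsqZ innerZr /a.
case: (inner u v) => x y; rewrite /cmod2/= => h.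
rewrite -subr_ge0 -(@pmulr_lge0 _ (normsq v)^-1) ?invr_gt0//.
by apply: le_trans h _; rewrite le_eqVlt; apply/orP; left; apply/eqP; field.
Qed.

Lemma cmeasurableB (f g : R -> R[i]) : cmeasurable f -> cmeasurable g ->
  cmeasurable (fun t => f t - g t).
Proof.
move=> [mrf mif] [mrg mig]; split.
  rewrite (_ : reF _ = fun t => reF f t - reF g t); first exact: measurable_funB.
  by apply/funext => t; rewrite /reF raddfB.
rewrite (_ : imF _ = fun t => imF f t - imF g t); first exact: measurable_funB.
by apply/funext => t; rewrite /imF raddfB.
Qed.

Lemma square_integrableB (f g : R -> R[i]) :
  square_integrable f -> square_integrable g ->
  square_integrable (fun t => f t - g t).
Proof.
move=> sf sg; have : f - g \in @L2pred R by apply: rpredB; exact/asboolP.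
by move/asboolP.
Qed.

Lemma integral_cmod2B u v :
  (\int[mu]_t (cmod2 (repr u t - repr v t))%:E = (normsq (u - v))%:E)%E.
Proof.
have s w : square_integrable (repr w) by exact: repr_square_integrable.
have mB : cmeasurable (fun t => repr u t - repr v t).
  by apply: cmeasurableB; [case: (s u)|case: (s v)].
rewrite /normsq /Rintegral fineK; last first.
  exact: (integrable_fin_num measurableT (L1_cmod2_repr (u - v))).
have hB : {ae mu, forall t, repr (u - v) t = repr u t - repr v t}.
  have := reprD_ae u (- v); have := reprZ_ae (-1) v; rewrite scaleN1r.
  apply: (@filterS2 _ _ (ae_filter_ringOfSetsType mu)) => t -> ->.
  by rewrite mulN1r.
apply: ae_eq_integral => //.
- exact: measurable_cmod2.
- by apply: measurable_cmod2; have [] := s (u - v).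
- by apply: (@filterS _ _ (ae_filter_ringOfSetsType mu) _ _ _ hB) => t -> _.
Qed.

Lemma cvg_cmod2B (z w : R[i]) (f : nat -> R[i]) :
  complex.Re (f n) @[n --> \oo] --> complex.Re w ->
  complex.Im (f n) @[n --> \oo] --> complex.Im w ->
  cmod2 (z - f n) @[n --> \oo] --> cmod2 (z - w).
Proof.
move=> fr fi.
have cr : complex.Re z - complex.Re (f n) @[n --> \oo] --> complex.Re z - complex.Re w.
  by apply: cvgB => //; exact: cvg_cst.
have ci : complex.Im z - complex.Im (f n) @[n --> \oo] --> complex.Im z - complex.Im w.
  by apply: cvgB => //; exact: cvg_cst.
rewrite /cmod2; under eq_fun do rewrite !raddfB !expr2.
by rewrite !raddfB !expr2; apply: cvgD; apply: cvgM.
Qed.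

Lemma measurable_limn_einf (f : nat -> R -> \bar R) :
  (forall n, measurable_fun [set: R] (f n)) ->
  measurable_fun [set: R] (fun t => limn_einf (f ^~ t)).
Proof.
move=> mf; rewrite (_ : (fun t => _) = -%E \o (fun t => limn_esup (fun n => - f n t)%E)).
  apply: measurableT_comp => //; apply: measurable_fun_limn_esup => n.
  exact: measurableT_comp.
apply/funext => t /=; rewrite -limn_einfN; congr limn_einf.
by apply/funext => n; rewrite /= oppeK.
Qed.

Lemma limn_einf_le (x : nat -> \bar R) (l : \bar R) :
  (forall n, (x n <= l)%E) -> (limn_einf x <= l)%E.
Proof.
move=> xl; rewrite limn_einf_lim; apply: lime_le; first exact: is_cvg_einfs.
apply: nearW => n; apply: le_trans (xl n).
by apply: ereal_inf_lbound; exists n => /=.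
Qed.

(** A rapidly converging subsequence has an almost-everywhere limit, separately for real and
    imaginary parts. Fatou's lemma then compares each late term of the full sequence with that
    limit. *)
Lemma L2_complete (u : nat -> L2 R) :
  (forall e : R, 0 < e -> exists N, forall m n, (N <= m)%N -> (N <= n)%N ->
    normsq (u m - u n) <= e) ->
  exists v, forall e : R, 0 < e -> exists N, forall n, (N <= n)%N ->
    normsq (u n - v) <= e.
Proof.
move=> uC.
have e4 j : 0 < 4^-1 ^+ j :> R by rewrite exprn_gt0.
pose N j := sval (cid (uC _ (e4 j))).
have NP j m n : (N j <= m)%N -> (N j <= n)%N -> normsq (u m - u n) <= 4^-1 ^+ j.
  exact: (svalP (cid (uC _ (e4 j)))).
(* With the running maximum, [phi j] and [phi j.+1] are both at least [N j], so consecutive terms of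
   the subsequence are within 4^(-j) in squared norm. *)
pose phi j := \max_(i < j.+1) N i.
have phiN i j : (i <= j)%N -> (N i <= phi j)%N.
  by move=> ij; rewrite /phi (leq_bigmax (Ordinal (ij : (i < j.+1)%N))).
pose f j := repr (u (phi j)).
have mf j : cmeasurable (f j) by have [] := repr_square_integrable (u (phi j)).
have step j : (\int[mu]_t (cmod2 (f j.+1 t - f j t))%:E <= (4^-1 ^+ j)%:E)%E.
  by rewrite integral_cmod2B lee_fin NP// phiN.
have mstep j (k : R -> R) : measurable_fun [set: R] k ->
  (forall t, k t ^+ 2 <= cmod2 (f j.+1 t - f j t)) ->
  (\int[mu]_t (k t ^+ 2)%:E <= (4^-1 ^+ j)%:E)%E.
  move=> mk kf; apply: le_trans (step j); apply: ge0_le_integral => //.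
  - by move=> t _; rewrite lee_fin sqr_ge0.
  - by apply/measurable_EFinP; exact: measurable_funX.
  - by apply: measurable_cmod2; exact: cmeasurableB.
  - by move=> t _; rewrite lee_fin.
have [fr mfr fr_lim] : exists2 g : R -> R, measurable_fun [set: R] g &
    {ae mu, forall t, reF (f n) t @[n --> \oo] --> g t}.
  apply: L2_fast_cauchy_ae => j; first by have [] := mf j.
  apply: mstep; first by apply: measurable_funB; [case: (mf j.+1)|case: (mf j)].
  by move=> t; rewrite /reF /cmod2 !raddfB lerDl sqr_ge0.
have [fi mfi fi_lim] : exists2 g : R -> R, measurable_fun [set: R] g &
    {ae mu, forall t, imF (f n) t @[n --> \oo] --> g t}.
  apply: L2_fast_cauchy_ae => j; first by have [] := mf j.
  apply: mstep; first by apply: measurable_funB; [case: (mf j.+1)|case: (mf j)].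
  by move=> t; rewrite /imF /cmod2 !raddfB lerDr sqr_ge0.
pose g t : R[i] := fr t +i* fi t.
have mg : cmeasurable g by split.
(* The shift by j keeps every index [phi (i + j)] above [N j], so one bound 4^(-j) holds for all i
   and survives the lower limit. *)
have lim n j : {ae mu, forall t,
    limn_einf (fun i => (cmod2 (repr (u n) t - f (i + j)%N t))%:E) =
    (cmod2 (repr (u n) t - g t))%:E}.
  apply: (@filterS2 _ _ (ae_filter_ringOfSetsType mu) _ _ _ _ fr_lim fi_lim) => t ft gt.
  have h : (cmod2 (repr (u n) t - f (i + j)%N t))%:E @[i --> \oo] -->
      (cmod2 (repr (u n) t - g t))%:E.
    apply: cvg_EFin; first exact: nearW.
    have := @cvg_cmod2B (repr (u n) t) (g t) (fun i => f i t) ft gt.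
    by rewrite -(cvg_shiftn j).
  rewrite is_cvg_limn_einfE; last by apply/cvg_ex; eexists; exact: h.
  exact: cvg_lim h.
have close j n : (N j <= n)%N ->
    (\int[mu]_t (cmod2 (repr (u n) t - g t))%:E <= (4^-1 ^+ j)%:E)%E.
  move=> jn.
  have mun : cmeasurable (repr (u n)) by have [] := repr_square_integrable (u n).
  have mcm i : measurable_fun [set: R] (fun t => (cmod2 (repr (u n) t - f i t))%:E).
    by apply: measurable_cmod2; exact: cmeasurableB.
  rewrite (@ae_eq_integral _ _ _ mu setT
    (fun t => limn_einf (fun i => (cmod2 (repr (u n) t - f (i + j)%N t))%:E)))//.
  - apply: le_trans (@fatou _ _ _ mu setT measurableT
      (fun i t => (cmod2 (repr (u n) t - f (i + j)%N t))%:E) (fun i => mcm _) _) _.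
      by move=> i t _; rewrite lee_fin cmod2_ge0.
    apply: limn_einf_le => i.
    rewrite integral_cmod2B lee_fin NP// phiN// leq_addl//.
  - by apply: measurable_cmod2; exact: cmeasurableB.
  - by apply: measurable_limn_einf => i; exact: mcm.
  - by apply: (@filterS _ _ (ae_filter_ringOfSetsType mu) _ _ _ (lim n j)) => t -> _.
have sg : square_integrable g.
  have su := repr_square_integrable (u (N 0%N)).
  (* The limit g is square integrable as u - (u - g), the difference being controlled by Fatou. *)
  have sd : square_integrable (fun t => repr (u (N 0%N)) t - g t).
    split; first by apply: cmeasurableB => //; case: su.
    by apply: le_lt_trans (close 0%N _ (leqnn _)) _; rewrite ltry.
  have := square_integrableB su sd; rewrite (_ : (fun t => _) = g)//.
  by apply/funext => t; rewrite subKr.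
exists (toL2 g) => e e0.
have [j je] : exists j, 4^-1 ^+ j <= e.
  have : 4^-1 ^+ n @[n --> \oo] --> (0 : R) by apply: cvg_expr; rewrite ger0_norm; lra.
  move=> /cvgrPdist_le/(_ _ e0)[j _ /(_ j (leqnn _))] /= h; exists j.
  by move: h; rewrite sub0r normrN ger0_norm// exprn_ge0.
exists (N j) => n jn; apply: le_trans je.
rewrite -lee_fin -integral_cmod2B; apply: le_trans (close j n jn).
rewrite (@ae_eq_integral _ _ _ mu setT (fun t => (cmod2 (repr (u n) t - g t))%:E))//.
- by apply: measurable_cmod2; apply: cmeasurableB;
    [have [] := repr_square_integrable (u n)|have [] := repr_square_integrable (toL2 g)].
- by apply: measurable_cmod2; apply: cmeasurableB => //; have [] := repr_square_integrable (u n).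
- apply: (@filterS _ _ (ae_filter_ringOfSetsType mu) _ _ _ (repr_toL2_ae sg)).
  by move=> t -> _.
Qed.

End HilbertSpace.

(** * Completeness of the Hermite functions *)

Section HermiteComplete.
Context {R : realType}.
Implicit Types (f g : R -> R) (u v : L2 R) (p : {poly R}) (e t : R).
Local Notation mu := (@lebesgue_measure R).
Local Notation L1 f := (mu.-integrable [set: R] (EFin \o f)).

Lemma L1_gauss e : 0 < e -> L1 (fun t => expR (- (e * t ^+ 2))).
Proof.
move=> e0; have [M hM] := poly_gauss_bounded 2 e0.
apply: (@L1_decay _ _ (1 + M)).
  apply: measurableT_comp => //; apply: measurableT_comp => //.
  by apply: measurable_funM => //; exact: measurable_funX.
move=> t; rewrite mulrDl mul1r lerD//.
  rewrite ger0_norm ?expR_ge0// expR_le1 oppr_le0 mulr_ge0 ?sqr_ge0//; exact: ltW.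
by apply: le_trans (hM t); rewrite normrM (ger0_norm (sqr_ge0 _)).
Qed.

(** This class contains both the square-integrable functions and the bounded ones. A difference
    between an element of L2 and a Fourier integral, which is at first only known to be bounded,
    therefore lies in it. *)
Definition gauss_integrable g := forall e, 0 < e -> L1 (fun t => g t * expR (- (e * t ^+ 2))).

Lemma gauss_integrable_bounded g M : measurable_fun [set: R] g ->
  (forall t, `|g t| <= M) -> gauss_integrable g.
Proof.
move=> mg gM e e0; apply: L1_eq (L1_Mbounded (L1_gauss e0) mg gM) => t.
by rewrite mulrC.
Qed.

Lemma gauss_integrable_sqr g : measurable_fun [set: R] g ->
  L1 (fun t => g t ^+ 2) -> gauss_integrable g.
Proof.
move=> mg Ig e e0; have e2 : 0 < 2 * e by lra.
have me : measurable_fun [set: R] (fun t : R => expR (- (e * t ^+ 2))).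
  exact: (L1_measurable (L1_gauss e0)).
apply: L1_le (L1D Ig (L1_gauss e2)); first exact: measurable_funM.
move=> t; rewrite [in leRHS](_ : - (2 * e * t ^+ 2) = - (e * t ^+ 2) + - (e * t ^+ 2)).
  rewrite expRD; set x := expR _; rewrite ler_norml.
  have := sqr_ge0 (g t - x); have := sqr_ge0 (g t + x).
  by move=> *; apply/andP; split; nra.
by ring.
Qed.

Lemma gauss_integrableB f g : gauss_integrable f -> gauss_integrable g ->
  gauss_integrable (fun t => f t - g t).
Proof.
by move=> If Ig e e0; apply: L1_eq (L1B (If e e0) (Ig e e0)) => t; rewrite mulrBl.
Qed.

Lemma L1_gauss_gpoly g p : gauss_integrable g ->
  L1 (fun t => g t * gpoly p t).
Proof.
move=> Ig; have half : 0 < 2^-1 :> R by [].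
have h n := L1_gauss_moment Ig n half.
apply: L1_eq (L1_sum (size p) (fun k => L1Z p`_k (h k))) => // t.
rewrite /gpoly horner_coef mulr_suml mulr_sumr; apply: eq_bigr => k _.
by rewrite mulrC [2^-1 * _]mulrC; ring.
Qed.

(** As H_n has degree exactly n, subtracting a multiple of it removes the leading term of a
    polynomial of degree n. *)
Lemma hermite_span_eq0 (L : {poly R} -> R) :
  (forall p q : {poly R}, L (p + q) = L p + L q) -> (forall (a : R) p, L (a *: p) = a * L p) ->
  (forall n, L (hermite_poly n) = 0) -> forall p, L p = 0.
Proof.
move=> LD LZ L0 p; move: {2}(size p) (leqnn (size p)) => n.
elim: n p => [|n IH] p.
  by rewrite leqn0 size_poly_eq0 => /eqP ->; rewrite -(scale0r 0) LZ mul0r.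
move=> pn; pose H : {poly R} := hermite_poly n.
have sH : size H = n.+1 := size_hermite_poly n.
have H0 : H`_n != 0.
  have : lead_coef H != 0 by rewrite lead_coef_eq0 -size_poly_eq0 sH.
  by rewrite lead_coefE sH.
pose q := p - (p`_n / H`_n) *: H.
have -> : p = q + (p`_n / H`_n) *: H by rewrite subrK.
rewrite LD LZ [L H]L0 mulr0 addr0; apply: IH.
apply/leq_sizeP => j; rewrite leq_eqVlt => /predU1P[<-|nj].
  by rewrite coefB coefZ divfK// subrr.
have pj : p`_j = 0 by rewrite nth_default// (leq_trans pn).
have Hj : H`_j = 0 by rewrite nth_default// sH.
by rewrite coefB coefZ pj Hj mulr0 subr0.
Qed.

Lemma hermite_complete g : measurable_fun [set: R] g -> gauss_integrable g ->
  (forall n, \int[mu]_t (g t * gpoly (hermite_poly n) t) = 0) ->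
  {ae mu, forall t, g t = 0}.
Proof.
move=> mg Ig g0; apply: moments_eq0_ae => // n.
pose L p := \int[mu]_t (g t * gpoly p t).
have L0 : L 'X^n = 0.
  apply: hermite_span_eq0 => // [p q|a p]; rewrite /L.
    rewrite -RintegralD//; try exact: L1_gauss_gpoly.
    by apply: eq_Rintegral => t _; rewrite gpolyD mulrDr.
  rewrite -RintegralZl//; last exact: L1_gauss_gpoly.
  by apply: eq_Rintegral => t _; rewrite gpolyZ mulrCA.
rewrite -[RHS]L0; apply: eq_Rintegral => t _.
by rewrite /gpoly hornerXn mulrA.
Qed.

Definition hvec n : L2 R := toL2 (hermite_fun n).

Lemma square_integrable_hermite n : square_integrable (@hermite_fun R n).
Proof.
rewrite hermite_funE; apply/square_integrableP; split.
  by split; [exact: measurable_gpoly|exact: measurable_cst].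
apply: L1_eq (L1_gpolyM (hermite_poly n) (hermite_poly n)) => t.
by rewrite /cmod2/= expr0n addr0 expr2.
Qed.

Lemma measurable_repr u :
  measurable_fun [set: R] (reF (repr u)) /\ measurable_fun [set: R] (imF (repr u)).
Proof. by have [] := repr_square_integrable u. Qed.

Lemma gauss_integrable_repr u :
  gauss_integrable (reF (repr u)) /\ gauss_integrable (imF (repr u)).
Proof.
have [mr mi] := measurable_repr u.
split; apply: gauss_integrable_sqr => //; apply: L1_le (L1_cmod2_repr u).
- exact: measurable_funX.
- by move=> t; rewrite ger0_norm ?sqr_ge0// /cmod2 lerDl sqr_ge0.
- exact: measurable_funX.
- by move=> t; rewrite ger0_norm ?sqr_ge0// /cmod2 lerDr sqr_ge0.
Qed.

Lemma inner_hvec u n : inner u (hvec n) =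
  (\int[mu]_t (reF (repr u) t * gpoly (hermite_poly n) t)) +i*
  (\int[mu]_t (imF (repr u) t * gpoly (hermite_poly n) t)).
Proof.
rewrite inner_toL2r; last exact: square_integrable_hermite.
rewrite hermite_funE /cintegral; congr (_ +i* _); apply: eq_Rintegral => t _;
  by rewrite /reF /imF; case: (repr u t) => a b /=; ring.
Qed.

(** The h_n are real-valued, so the real and imaginary parts of u are separately orthogonal to all
    of them. *)
Lemma L2_hermite_complete u : (forall n, inner u (hvec n) = 0) -> u = 0.
Proof.
move=> u0; have [mr mi] := measurable_repr u.
have [gr gi] := gauss_integrable_repr u.
have r0 : {ae mu, forall t, reF (repr u) t = 0}.
  by apply: hermite_complete => // n; have := u0 n; rewrite inner_hvec => -[].
have i0 : {ae mu, forall t, imF (repr u) t = 0}.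
  by apply: hermite_complete => // n; have := u0 n; rewrite inner_hvec => -[].
apply: eq_ae_repr; have := @repr0_ae R.
apply: (@filterS3 _ _ (ae_filter_ringOfSetsType mu) _ _ _ _ _ r0 i0) => t.
rewrite /reF /imF => rt it ->; move: rt it; by case: (repr u t) => a b /= -> ->.
Qed.

Lemma inner_hvec_hvec m n :
  inner (hvec m) (hvec n) = (gdot (hermite_poly m) (hermite_poly n))%:C.
Proof.
have sq := square_integrable_hermite.
rewrite inner_toL2r//.
transitivity (cintegral (fun t => hermite_fun m t * conjc (hermite_fun n t)) : R[i]).
  apply: ae_eq_cintegral.
  - apply: cmeasurableM; first by have [] := repr_square_integrable (hvec m).
    by apply: cmeasurable_conj; case: (sq n).
  - apply: cmeasurableM; first by case: (sq m).
    by apply: cmeasurable_conj; case: (sq n).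
  - apply: (@filterS _ _ (ae_filter_ringOfSetsType mu) _ _ _ (repr_toL2_ae (sq m))).
    by move=> t ->.
rewrite !hermite_funE; apply/eqP; rewrite eq_complex/=; apply/andP; split; apply/eqP.
  by apply: eq_Rintegral => t _; rewrite /reF /=; ring.
rewrite [LHS](_ : _ = \int[mu]_t 0); first by rewrite Rintegral_cst// mul0r.
by apply: eq_Rintegral => t _; rewrite /imF /=; ring.
Qed.

Lemma normsq_hvec n :
  normsq (hvec n) = gdot (hermite_poly n) (hermite_poly n).
Proof. by rewrite normsqE inner_hvec_hvec. Qed.

Lemma inner_hvec_neq m n : m != n -> inner (hvec m) (hvec n) = 0.
Proof. by move=> mn; rewrite inner_hvec_hvec gdot_hermite_neq. Qed.

Lemma normsq_hvec_gt0 n : 0 < normsq (hvec n).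
Proof. by rewrite normsq_hvec gdot_hermite_gt0. Qed.

End HermiteComplete.

(** * Orthogonal series in an unnormalized system *)

Section OrthogonalSeries.
Context {R : realType}.
Implicit Types (u v w : L2 R) (c : nat -> R[i]).
Variable e : nat -> L2 R.
Hypothesis e_orth : forall m n, m != n -> inner (e m) (e n) = 0.
Hypothesis e_gt0 : forall n, 0 < normsq (e n).

Definition partial_sum c n : L2 R := \sum_(k < n) c k *: e k.
Definition energy c n : R := \sum_(k < n) cmod2 (c k) * normsq (e k).

Lemma inner_partial_sum c n k :
  inner (partial_sum c n) (e k) = ((k < n)%N)%:R * (c k * (normsq (e k))%:C).
Proof.
rewrite inner_suml; have [kn|nk] := ltnP k n.
  rewrite (bigD1 (Ordinal kn))//= innerZl inner_diag big1 ?addr0 ?mul1r// => i ik.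
  by rewrite innerZl e_orth ?mulr0.
rewrite mul0r big1// => i _; rewrite innerZl e_orth ?mulr0//.
by rewrite neq_ltn (leq_trans (ltn_ord i)).
Qed.

(** Pythagoras. Only the first n coefficients of v are prescribed, so v may be a longer partial sum,
    which gives the Cauchy property, as well as the limit. *)
Lemma normsqB_partial_sum v c n :
  (forall k, (k < n)%N -> inner v (e k) = c k * (normsq (e k))%:C) ->
  normsq (v - partial_sum c n) = normsq v - energy c n.
Proof.
elim: n => [|n IH] vc; first by rewrite /partial_sum /energy !big_ord0 !subr0.
rewrite /partial_sum big_ord_recr/= -/(partial_sum c n) opprD addrA normsqB.
rewrite IH => [|k kn]; last by rewrite vc// ltnW.
rewrite innerBl !innerZr inner_partial_sum ltnn mul0r mulr0 subr0 vc// normsqZ.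
rewrite /energy big_ord_recr/=; case: (c n) => x y; rewrite /cmod2/=; ring.
Qed.

Lemma normsq_partial_sum c n : normsq (partial_sum c n) = energy c n.
Proof.
have := @normsqB_partial_sum (partial_sum c n) c n.
rewrite subrr normsq0 => h; apply/eqP; rewrite -subr_eq0 -h// => k kn.
by rewrite inner_partial_sum kn mul1r.
Qed.

Lemma energy_nondecreasing c m n : (m <= n)%N -> energy c m <= energy c n.
Proof.
move=> /subnKC <-; elim: (n - m)%N => [|d IH]; first by rewrite addn0.
apply: le_trans IH _; rewrite addnS /energy big_ord_recr/= lerDl.
by rewrite mulr_ge0 ?cmod2_ge0 ?normsq_ge0.
Qed.

Definition coef u k : R[i] := (normsq (e k))^-1%:C * inner u (e k).

Lemma coefP u k : inner u (e k) = coef u k * (normsq (e k))%:C.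
Proof.
have nz : normsq (e k) != 0 by rewrite gt_eqF.
rewrite /coef; case: (inner u (e k)) => x y; apply/eqP; rewrite eq_complex/=.
by apply/andP; split; apply/eqP; field.
Qed.

Lemma bessel u n : energy (coef u) n <= normsq u.
Proof.
by rewrite -subr_ge0 -normsqB_partial_sum ?normsq_ge0// => k _; exact: coefP.
Qed.

(** Bounded energies form a convergent sequence, and the squared distance of two partial sums is the
    difference of their energies. *)
Lemma orth_series_cvg c M : (forall n, energy c n <= M) ->
  exists v, (forall k, inner v (e k) = c k * (normsq (e k))%:C) /\
    forall eps : R, 0 < eps -> exists N, forall n, (N <= n)%N ->
      normsq (partial_sum c n - v) <= eps.
Proof.
move=> cM.
have cE : cvgn (energy c).
  apply: nondecreasing_is_cvgn; first by move=> m n; exact: energy_nondecreasing.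
  by exists M => _ [n _ <-].
have Ele n : energy c n <= limn (energy c).
  by apply: nondecreasing_cvgn_le => // i j; exact: energy_nondecreasing.
have : exists v, forall eps : R, 0 < eps -> exists N, forall n, (N <= n)%N ->
    normsq (partial_sum c n - v) <= eps.
  apply: L2_complete => eps eps0.
  move: (cE) => /cvgrPdist_le/(_ _ eps0)[N _ NP]; exists N.
  have h m n : (N <= m)%N -> (m <= n)%N -> normsq (partial_sum c n - partial_sum c m) <= eps.
    move=> Nm mn; rewrite normsqB_partial_sum; last first.
      by move=> k km; rewrite inner_partial_sum (leq_trans km mn) mul1r.
    rewrite normsq_partial_sum; have := NP m Nm; have := Ele n; have := Ele m.
    by rewrite ler_norml => ? ? /andP[? ?]; lra.
  move=> m n Nm Nn; have [mn|/ltnW nm] := leqP m n; last exact: h.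
  by rewrite -normsqN opprB; exact: h.
move=> [v vP]; exists v; split => // k.
apply/eqP; rewrite -subr_eq0; apply/eqP/cmod2_eq0/eqP.
rewrite eq_le cmod2_ge0 andbT; apply/ler_addgt0Pl => eps eps0; rewrite addr0.
have eps' : 0 < eps / normsq (e k) by rewrite divr_gt0.
have [N NP] := vP _ eps'.
(* The index must exceed k for the partial sum to contain the k-th term. Cauchy-Schwarz then carries
   its coefficient to the limit. *)
have := NP (maxn N k.+1) (leq_maxl _ _); rewrite ler_pdivlMr//; apply: le_trans.
rewrite -[normsq (_ - v)]normsqN opprB; apply: le_trans (cauchy_schwarz _ _).
by rewrite innerBl inner_partial_sum leq_maxr mul1r.
Qed.

(** Factors of modulus 1 leave the energies unchanged, so Bessel's inequality for u bounds the new
    series. *)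
Lemma orth_multiplier_energy (z : nat -> R[i]) u : (forall k, cmod2 (z k) = 1) ->
  exists v, (forall k, inner v (e k) = z k * inner u (e k)) /\
    forall eps : R, 0 < eps -> exists N, forall n, (N <= n)%N ->
      normsq v - energy (coef u) n <= eps.
Proof.
move=> z1; pose c k := z k * coef u k.
have cE : energy c = energy (coef u).
  by apply/funext => n; apply: eq_bigr => k _; rewrite cmod2M z1 mul1r.
have cM n : energy c n <= normsq u by rewrite cE; exact: bessel.
have [v [vc vlim]] := orth_series_cvg cM; exists v; split.
  by move=> k; rewrite vc coefP mulrA.
move=> eps /vlim[N NP]; exists N => n /NP.
by rewrite -normsqN opprB normsqB_partial_sum ?cE.
Qed.

Hypothesis e_complete : forall u, (forall k, inner u (e k) = 0) -> u = 0.

(** The multiplier 1 produces a vector w with the coefficients of u and with energies tending to its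
    squared norm; completeness gives w = u. *)
Lemma parseval u (eps : R) : 0 < eps -> exists N, forall n, (N <= n)%N ->
  normsq u - energy (coef u) n <= eps.
Proof.
have one (k : nat) : cmod2 ((fun=> 1 : R[i]) k) = 1 by rewrite /cmod2/= expr1n expr0n addr0.
have [w [wc wlim]] := orth_multiplier_energy u one.
suff wu : w = u by move=> eps0; have := wlim _ eps0; rewrite wu.
apply/eqP; rewrite -subr_eq0; apply/eqP/e_complete => k.
by rewrite innerBl wc mul1r subrr.
Qed.

(** Both squared norms are the limit of the same energies. *)
Lemma orth_multiplier (z : nat -> R[i]) u : (forall k, cmod2 (z k) = 1) ->
  exists v, (forall k, inner v (e k) = z k * inner u (e k)) /\ normsq v = normsq u.
Proof.
move=> z1; have [v [vc vlim]] := orth_multiplier_energy u z1; exists v; split => //.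
have vle n : energy (coef u) n <= normsq v.
  have -> : energy (coef u) n = energy (coef v) n.
    apply: eq_bigr => k _; congr (_ * _).
    by rewrite /coef vc !cmod2M z1 mul1r.
  exact: bessel.
apply/eqP; rewrite eq_le; apply/andP; split; apply/ler_addgt0Pl => eps eps0.
  have [N /(_ N (leqnn _))] := vlim _ eps0; have := bessel u N; lra.
have [N /(_ N (leqnn _))] := parseval u eps0; have := vle N; lra.
Qed.

End OrthogonalSeries.

(** * The Fourier operator *)

Section FourierOperator.
Context {R : realType}.
Implicit Types (f g k : R -> R) (u v w : L2 R) (t x : R).
Local Notation mu := (@lebesgue_measure R).
Local Notation L1 f := (mu.-integrable [set: R] (EFin \o f)).

Section Transform.
Variable k : R -> R.
Hypothesis k_cont : continuous k.
Hypothesis k_le1 : forall x, `|k x| <= 1.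

(** An abstract bounded continuous kernel treats the cosine and the sine at once. *)
Definition transform f t : R := \int[mu]_x (f x * k (t * x)).

Lemma measurable_kernel t : measurable_fun [set: R] (fun x => k (t * x)).
Proof.
apply: continuous_measurable_fun => x; apply: continuous_comp; last exact: k_cont.
exact: mulrl_continuous.
Qed.

Lemma L1_kernel f t : L1 f -> L1 (fun x => f x * k (t * x)).
Proof.
move=> If; apply: (@L1_Mbounded _ _ _ 1) => //; exact: measurable_kernel.
Qed.

Lemma transform_bounded f t : L1 f -> `|transform f t| <= \int[mu]_x `|f x|.
Proof.
move=> If; apply: le_trans (le_normr_Rintegral measurableT (L1_kernel t If)) _.
apply: le_Rintegral => //; first exact/L1_norm/L1_kernel.
  exact: L1_norm.
by move=> x _; rewrite normrM ler_piMr.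
Qed.

Lemma integral_EFin f : L1 f -> (\int[mu]_x (f x)%:E)%E = (\int[mu]_x f x)%:E.
Proof. by move=> If; rewrite fineK//; exact: (integrable_fin_num measurableT If). Qed.

Section Kernel.
Variables f g : R -> R.
Hypotheses (If : L1 f) (Ig : L1 g).

Let K (z : R * R) : R := f z.2 * g z.1 * k (z.1 * z.2).

Let mK : measurable_fun [set: R * R] K.
Proof.
have mf := L1_measurable If; have mg := L1_measurable Ig.
apply: measurable_funM; first apply: measurable_funM.
- exact: measurableT_comp.
- exact: measurableT_comp.
- apply: measurableT_comp; first exact: continuous_measurable_fun.
  exact: measurable_funM.
Qed.

Let L1_K1 t : L1 (fun x => K (t, x)).
Proof. by apply: L1_eq (L1Z (g t) (L1_kernel t If)) => x; rewrite /K/=; ring. Qed.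

Let integral_K1 t : (\int[mu]_x (K (t, x))%:E)%E = (transform f t * g t)%:E.
Proof.
rewrite integral_EFin// mulrC -RintegralZl//; last exact: L1_kernel.
by congr _%:E; apply: eq_Rintegral => x _; rewrite /K/=; ring.
Qed.

Let integral_K2 x : (\int[mu]_t (K (t, x))%:E)%E = (f x * transform g x)%:E.
Proof.
rewrite integral_EFin//; last first.
  by apply: L1_eq (L1Z (f x) (L1_kernel x Ig)) => t; rewrite /K/= [t * x]mulrC; ring.
rewrite -RintegralZl//; last exact: L1_kernel.
by congr _%:E; apply: eq_Rintegral => t _; rewrite /K/= [t * x]mulrC; ring.
Qed.

(** Tonelli's criterion: as |k| <= 1, the inner integral of |K| is at most |g t| times the L^1 norm
    of f. *)
Let integrable_K : (mu \x mu)%E.-integrable setT (EFin \o K).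
Proof.
have mEK : measurable_fun setT (EFin \o K) by exact/measurable_EFinP.
apply/integrable12ltyP => //.
pose C := \int[mu]_x `|f x|.
apply: (@le_lt_trans _ _ (\int[mu]_t (C * `|g t|)%:E)%E); last first.
  rewrite integral_EFin ?ltry//; exact/L1Z/L1_norm.
apply: ge0_le_integral => //.
- by move=> t _; exact: integral_ge0.
- have mabs : measurable_fun setT (fun z => `|(EFin \o K) z|)%E by exact: measurableT_comp.
  have := @measurable_fun_fubini_tonelli_F _ _ _ _ R mu _ mabs; apply.
  by move=> z; exact: abse_ge0.
- by apply/measurable_EFinP; apply: measurable_funM => //; apply: L1_measurable; exact: L1_norm.
- move=> t _; rewrite [leLHS](@integral_EFin (fun x => `|K (t, x)|)); last exact: L1_norm.
  rewrite lee_fin mulrC -RintegralZl//; last exact: L1_norm.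
  apply: le_Rintegral => //; first exact: L1_norm.
    exact/L1Z/L1_norm.
  by move=> x _; rewrite /K/= !normrM [`|g t| * _]mulrC ler_piMr// mulr_ge0.
Qed.

Lemma transform_adjoint :
  \int[mu]_t (transform f t * g t) = \int[mu]_x (f x * transform g x).
Proof.
rewrite /Rintegral; congr fine.
under eq_integral do rewrite -integral_K1.
by rewrite (Fubini integrable_K)/=; under eq_integral do rewrite integral_K2.
Qed.

Lemma measurable_transformM : measurable_fun [set: R] (fun t => transform f t * g t).
Proof.
have h := measurable_fubini_F integrable_K; apply/measurable_EFinP.
by apply: eq_measurable_fun h => t _; rewrite /fubini_F/= integral_K1.
Qed.

End Kernel.

(** Fubini gives measurability of the transform times an integrable g. Here g is the Gaussian, which
    never vanishes and is divided out. *)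
Lemma measurable_transform f : L1 f -> measurable_fun [set: R] (transform f).
Proof.
move=> If; have h := measurable_transformM If (L1_gpoly 1).
rewrite (_ : transform f = fun t => transform f t * gpoly 1 t * expR (t ^+ 2 / 2)).
  apply: measurable_funM => //; apply: measurableT_comp => //.
  by apply: measurable_funM => //; exact: measurable_funX.
apply/funext => t.
by rewrite /gpoly hornerC mul1r -mulrA -expRD addrC subrr expR0 mulr1.
Qed.

Lemma gauss_integrable_transform f : L1 f -> gauss_integrable (transform f).
Proof.
move=> If; apply: (gauss_integrable_bounded (measurable_transform If)) => t.
exact: transform_bounded.
Qed.

End Transform.

Lemma cos_transformE f : cos_transform f = transform (@cos R) f. Proof. by []. Qed.
Lemma sin_transformE f : sin_transform f = transform (@sin R) f. Proof. by []. Qed.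

Lemma real_schwartz_measurable f : real_schwartz f -> measurable_fun [set: R] f.
Proof.
move=> [df _]; apply: continuous_measurable_fun => t.
by apply: differentiable_continuous; apply/derivable1_diffP; exact: (df 0%N t).
Qed.

Lemma real_schwartz_decay f : real_schwartz f ->
  exists M : R, forall t, (1 + t ^+ 2) * `|f t| <= M.
Proof.
move=> [_ bf]; have [M0 h0] := bf 0%N 0%N; have [M2 h2] := bf 2%N 0%N.
exists (M0 + M2) => t; rewrite mulrDl mul1r; apply: lerD.
  by have := h0 t; rewrite expr0 mul1r.
by have := h2 t; rewrite normrM (ger0_norm (sqr_ge0 t)).
Qed.

Lemma L1_real_schwartz f : real_schwartz f -> L1 f.
Proof.
move=> sf; have [M fM] := real_schwartz_decay sf.
exact: L1_decay (real_schwartz_measurable sf) fM.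
Qed.

Lemma L1_sqr_real_schwartz f : real_schwartz f -> L1 (fun t => f t ^+ 2).
Proof.
move=> sf; have [M fM] := real_schwartz_decay sf.
have mf := real_schwartz_measurable sf.
apply: L1_eq (L1_Mbounded (L1_real_schwartz sf) mf (_ : forall t, `|f t| <= M)) => t.
  by rewrite expr2.
apply: le_trans (fM t); rewrite ler_peMl// lerDl sqr_ge0//.
Qed.

Lemma square_integrable_schwartz (f : R -> R[i]) : schwartz f -> square_integrable f.
Proof.
move=> [sr si]; apply/square_integrableP; split.
  by split; exact: real_schwartz_measurable.
exact: L1D (L1_sqr_real_schwartz sr) (L1_sqr_real_schwartz si).
Qed.

Lemma fourier_integralE (f : R -> R[i]) : L1 (reF f) -> L1 (imF f) ->
  fourier_integral f = fun t => (Num.sqrt (2 * pi))^-1%:C *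
    ((cos_transform (reF f) t - sin_transform (imF f) t) +i*
     (sin_transform (reF f) t + cos_transform (imF f) t)).
Proof.
move=> Ir Ii; apply/funext => t; rewrite /fourier_integral; congr (_ * _).
rewrite /cintegral; congr (_ +i* _).
  rewrite -RintegralB//; [|exact: L1_Mcos|exact: L1_Msin].
  by apply: eq_Rintegral => x _; rewrite /reF /imF; case: (f x).
rewrite -RintegralD//; [|exact: L1_Msin|exact: L1_Mcos].
by apply: eq_Rintegral => x _; rewrite /reF /imF; case: (f x).
Qed.

Lemma L2_hermite_inj u v : (forall n, inner u (hvec n) = inner v (hvec n)) -> u = v.
Proof.
move=> uv; apply/eqP; rewrite -subr_eq0; apply/eqP/L2_hermite_complete => n.
by rewrite innerBl uv subrr.
Qed.

Lemma inner_toL2_hvec (f : R -> R[i]) n : square_integrable f ->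
  inner (toL2 f) (hvec n) =
  (\int[mu]_t (reF f t * gpoly (hermite_poly n) t)) +i*
  (\int[mu]_t (imF f t * gpoly (hermite_poly n) t)).
Proof.
move=> sf; rewrite inner_toL2r; last exact: square_integrable_hermite.
transitivity (cintegral (fun t => f t * conjc (hermite_fun n t)) : R[i]).
  have mh := cmeasurable_conj (square_integrable_hermite n).1.
  apply: ae_eq_cintegral.
  - by apply: cmeasurableM => //; case: (repr_square_integrable (toL2 f)).
  - by apply: cmeasurableM => //; case: sf.
  - apply: (@filterS _ _ (ae_filter_ringOfSetsType mu) _ _ _ (repr_toL2_ae sf)).
    by move=> t ->.
rewrite hermite_funE /cintegral; congr (_ +i* _); apply: eq_Rintegral => t _;
  by rewrite /reF /imF; case: (f t) => a b /=; ring.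
Qed.

Lemma cmod2_iX n : cmod2 ((0 +i* 1) ^+ n : R[i]) = 1.
Proof.
elim: n => [|n IH]; first by rewrite expr0 /cmod2/= expr1n expr0n addr0.
by rewrite exprS cmod2M IH /cmod2/= expr1n expr0n add0r mulr1.
Qed.

Let Fspec u := orth_multiplier inner_hvec_neq normsq_hvec_gt0
  L2_hermite_complete u cmod2_iX.

(** The image of each u is chosen separately; linearity follows afterwards because the Hermite
    coefficients determine a vector. *)
Definition hermite_op u : L2 R := sval (cid (Fspec u)).

Lemma inner_hermite_op u n :
  inner (hermite_op u) (hvec n) = (0 +i* 1) ^+ n * inner u (hvec n).
Proof. by have [] := svalP (cid (Fspec u)). Qed.

Lemma normsq_hermite_op u : normsq (hermite_op u) = normsq u.
Proof. by have [] := svalP (cid (Fspec u)). Qed.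

Lemma hermite_op_linear : linear hermite_op.
Proof.
move=> a u v; apply: L2_hermite_inj => n.
by rewrite inner_hermite_op !innerDl !innerZl !inner_hermite_op; ring.
Qed.

(** Polarization: the norm of a sum gives the real part of the inner product, and replacing u by i u
    gives the imaginary part. *)
Lemma inner_polar (T : L2 R -> L2 R) : linear T ->
  (forall u, normsq (T u) = normsq u) -> forall u v, inner (T u) (T v) = inner u v.
Proof.
move=> linT nT u v.
have TD (x y : L2 R) : T (x + y) = T x + T y by have := linT 1 x y; rewrite !scale1r.
have T0 : T 0 = 0 by apply: normsq_eq0; rewrite nT normsq0.
have TZ a (x : L2 R) : T (a *: x) = a *: T x by have := linT a x 0; rewrite T0 !addr0.
have reT (x y : L2 R) : complex.Re (inner (T x) (T y)) = complex.Re (inner x y).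
  by have := nT (x + y); rewrite TD !normsqD !nT; lra.
have Rei (z : R[i]) : complex.Re ((0 +i* 1) * z) = - complex.Im z.
  by case: z => x y /=; ring.
apply/eqP; rewrite eq_complex reT eqxx andTb; apply/eqP/oppr_inj.
by rewrite -!Rei -!innerZl -TZ reT.
Qed.

Lemma hermite_op_unitary : unitary_op hermite_op.
Proof.
split; first exact: hermite_op_linear.
  exact: (inner_polar hermite_op_linear normsq_hermite_op).
(* A preimage is obtained from the multiplier with the conjugate factors, which invert i^n. *)
move=> v; have z1 n : cmod2 (conjc ((0 +i* 1) ^+ n : R[i])) = 1.
  by rewrite cmod2_conj cmod2_iX.
have [u [uv _]] := orth_multiplier inner_hvec_neq normsq_hvec_gt0
  L2_hermite_complete v z1.
exists u; apply: L2_hermite_inj => n; rewrite inner_hermite_op uv mulrA.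
rewrite [X in X * _](_ : _ = 1) ?mul1r//.
have := cmod2_iX n; case: (_ ^+ n) => a b; rewrite /cmod2/= => ab.
by apply/eqP; rewrite eq_complex/=; apply/andP; split; apply/eqP; [rewrite -ab|]; ring.
Qed.

(** * Agreement with the Fourier integral on Schwartz functions *)

Section OnSchwartz.
Variable f : R -> R[i].
Hypothesis sf : schwartz f.

Let f1 := reF f.
Let f2 := imF f.
Let If1 : L1 f1. Proof. by case: sf => /L1_real_schwartz. Qed.
Let If2 : L1 f2. Proof. by case: sf => _ /L1_real_schwartz. Qed.
Let s : R := (Num.sqrt (2 * pi))^-1.
Let w := hermite_op (toL2 f).
Let ccos := @continuous_cos R.
Let csin := @continuous_sin R.

Let g1 t := s * (cos_transform f1 t - sin_transform f2 t).
Let g2 t := s * (sin_transform f1 t + cos_transform f2 t).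

Let fourierE : fourier_integral f = fun t => g1 t +i* g2 t.
Proof.
rewrite fourier_integralE//; apply/funext => t; apply/eqP; rewrite eq_complex/=.
by rewrite !mul0r subr0 addr0 !eqxx.
Qed.

Let mC k : L1 k -> measurable_fun [set: R] (cos_transform k).
Proof. exact: (measurable_transform ccos (@normr_cos_le1 R)). Qed.
Let mS k : L1 k -> measurable_fun [set: R] (sin_transform k).
Proof. exact: (measurable_transform csin (@normr_sin_le1 R)). Qed.
Let gC k : L1 k -> gauss_integrable (cos_transform k).
Proof. exact: (gauss_integrable_transform ccos (@normr_cos_le1 R)). Qed.
Let gS k : L1 k -> gauss_integrable (sin_transform k).
Proof. exact: (gauss_integrable_transform csin (@normr_sin_le1 R)). Qed.

Let mg1 : measurable_fun [set: R] g1.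
Proof. by apply: measurable_funM => //; apply: measurable_funB; [exact: mC|exact: mS]. Qed.

Let mg2 : measurable_fun [set: R] g2.
Proof. by apply: measurable_funM => //; apply: measurable_funD; [exact: mS|exact: mC]. Qed.

Let gg1 : gauss_integrable g1.
Proof.
move=> e e0; apply: L1_eq (L1Z s (L1B (gC If1 e0) (gS If2 e0))) => t.
by rewrite /g1; ring.
Qed.

Let gg2 : gauss_integrable g2.
Proof.
move=> e e0; apply: L1_eq (L1Z s (L1D (gS If1 e0) (gC If2 e0))) => t.
by rewrite /g2; ring.
Qed.

Let H n := gpoly (hermite_poly n : {poly R}).

Let s2 : s * Num.sqrt (2 * pi) = 1.
Proof. by rewrite mulVf// gt_eqF// sqrtr_gt0 mulr_gt0 ?pi_gt0. Qed.

Let CH k n : L1 k -> \int[mu]_t (cos_transform k t * H n t) =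
  Num.sqrt (2 * pi) * complex.Re ((0 +i* 1) ^+ n : R[i]) * \int[mu]_t (k t * H n t).
Proof.
move=> Ik; rewrite (transform_adjoint ccos (@normr_cos_le1 R) Ik (L1_gpoly _)).
have IkH := L1_Mbounded Ik (measurable_gpoly _) (svalP (cid (gpoly_bounded (hermite_poly n)))).
rewrite -RintegralZl//; apply: eq_Rintegral => t _.
by rewrite -cos_transformE (hermite_transforms n t).1 /H; ring.
Qed.

Let SH k n : L1 k -> \int[mu]_t (sin_transform k t * H n t) =
  Num.sqrt (2 * pi) * complex.Im ((0 +i* 1) ^+ n : R[i]) * \int[mu]_t (k t * H n t).
Proof.
move=> Ik; rewrite (transform_adjoint csin (@normr_sin_le1 R) Ik (L1_gpoly _)).
have IkH := L1_Mbounded Ik (measurable_gpoly _) (svalP (cid (gpoly_bounded (hermite_poly n)))).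
rewrite -RintegralZl//; apply: eq_Rintegral => t _.
by rewrite -sin_transformE (hermite_transforms n t).2 /H; ring.
Qed.

Let inner_w n : inner w (hvec n) =
  (\int[mu]_t (g1 t * H n t)) +i* (\int[mu]_t (g2 t * H n t)).
Proof.
have IC k : L1 k -> L1 (fun t => cos_transform k t * H n t).
  by move=> Ik; exact/L1_gauss_gpoly/gC.
have IS k : L1 k -> L1 (fun t => sin_transform k t * H n t).
  by move=> Ik; exact/L1_gauss_gpoly/gS.
have -> : \int[mu]_t (g1 t * H n t) = s *
    ((\int[mu]_t (cos_transform f1 t * H n t)) - (\int[mu]_t (sin_transform f2 t * H n t))).
  rewrite -RintegralB//; [|exact: IC|exact: IS].
  rewrite -RintegralZl//; last by apply: L1B; [exact: IC|exact: IS].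
  by apply: eq_Rintegral => t _; rewrite /g1; ring.
have -> : \int[mu]_t (g2 t * H n t) = s *
    ((\int[mu]_t (sin_transform f1 t * H n t)) + (\int[mu]_t (cos_transform f2 t * H n t))).
  rewrite -RintegralD//; [|exact: IS|exact: IC].
  rewrite -RintegralZl//; last by apply: L1D; [exact: IS|exact: IC].
  by apply: eq_Rintegral => t _; rewrite /g2; ring.
rewrite !CH// !SH// inner_hermite_op inner_toL2_hvec; last exact: square_integrable_schwartz.
rewrite -/f1 -/f2 -/(H n); case: (_ ^+ n) => a b.
move: s2; set r := Num.sqrt _ => sr.
by apply/eqP; rewrite eq_complex/=; apply/andP; split; apply/eqP;
  rewrite -[LHS]mul1r -sr; ring.
Qed.

(** Both sides have the same Hermite coefficients, by [inner_w]. Their difference is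
    [gauss_integrable] although [g1] is not yet known to be square integrable, so completeness
    applies. *)
Let reF_w : {ae mu, forall t, reF (repr w) t = g1 t}.
Proof.
have [mw _] := measurable_repr w; have [gw _] := gauss_integrable_repr w.
have : {ae mu, forall t, reF (repr w) t - g1 t = 0}.
  apply: hermite_complete => [||n].
  - exact: measurable_funB.
  - exact: gauss_integrableB.
  - under eq_Rintegral do rewrite mulrBl.
    rewrite RintegralB//; try exact: L1_gauss_gpoly.
    by have := inner_w n; rewrite inner_hvec => -[-> _]; rewrite subrr.
apply: (@filterS _ _ (ae_filter_ringOfSetsType mu)) => t /eqP.
by rewrite subr_eq0 => /eqP.
Qed.

Let imF_w : {ae mu, forall t, imF (repr w) t = g2 t}.
Proof.
have [_ mw] := measurable_repr w; have [_ gw] := gauss_integrable_repr w.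
have : {ae mu, forall t, imF (repr w) t - g2 t = 0}.
  apply: hermite_complete => [||n].
  - exact: measurable_funB.
  - exact: gauss_integrableB.
  - under eq_Rintegral do rewrite mulrBl.
    rewrite RintegralB//; try exact: L1_gauss_gpoly.
    by have := inner_w n; rewrite inner_hvec => -[_ ->]; rewrite subrr.
apply: (@filterS _ _ (ae_filter_ringOfSetsType mu)) => t /eqP.
by rewrite subr_eq0 => /eqP.
Qed.

Lemma hermite_op_schwartz : hermite_op (toL2 f) = toL2 (fourier_integral f).
Proof.
rewrite -/w -[LHS]toL2_repr.
have wE : {ae mu, forall t, repr w t = fourier_integral f t}.
  apply: (@filterS2 _ _ (ae_filter_ringOfSetsType mu) _ _ _ _ reF_w imF_w) => t.
  by rewrite fourierE /reF /imF; case: (repr w t) => a b /= -> ->.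
have mF : cmeasurable (fourier_integral f) by rewrite fourierE; split.
have sw := repr_square_integrable w.
(* [toL2] returns 0 outside the square-integrable functions, so the Fourier integral has to be shown
   square integrable. It inherits this from [w], to which it is equal almost everywhere. *)
apply: toL2_ae_eq => //; split => //; case: sw => mw; apply: le_lt_trans.
rewrite (@ae_eq_integral _ _ _ mu setT (fun t => (cmod2 (repr w t))%:E))//.
- exact: measurable_cmod2.
- exact: measurable_cmod2.
- by apply: (@filterS _ _ (ae_filter_ringOfSetsType mu) _ _ _ wE) => t ->.
Qed.

End OnSchwartz.

(** The witness [hermite_op] makes [xget] return an operator with the specification rather than its
    default; the proofs below use this specification only. *)
Lemma fourier_is_fourier : is_fourier (@fourier R).
Proof.
have h : is_fourier hermite_op.
  by split; [exact: hermite_op_unitary|exact: hermite_op_schwartz].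
exact: xgetI h.
Qed.

End FourierOperator.

(** * Spectral decomposition *)

Section FourierSpectrum.
Context {R : realType}.
Implicit Types (u v w : L2 R) (lambda : R[i]).
Local Notation F := (@fourier R).
Local Notation i := (0 +i* 1 : R[i]).

Lemma sqr_i : i ^+ 2 = -1.
Proof. by apply/eqP; rewrite eq_complex /=; apply/andP; split; apply/eqP; ring. Qed.

Lemma iX4 n : (i ^+ n) ^+ 4 = 1.
Proof. by rewrite exprAC (exprM i 2 2) sqr_i sqrrN expr1n expr1n. Qed.

Lemma iX_conj n : i ^+ n * conjc (i ^+ n) = 1.
Proof.
have := @cmod2_iX R n; case: (i ^+ n) => a b; rewrite /cmod2/= => ab.
by apply/eqP; rewrite eq_complex/=; apply/andP; split; apply/eqP; [rewrite -ab|]; ring.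
Qed.

Lemma fourier_inner u v : inner (F u) (F v) = inner u v.
Proof. by have [[_ h _] _] := @fourier_is_fourier R; exact: h. Qed.

Lemma fourier_linear : linear F.
Proof. by have [[h _ _] _] := @fourier_is_fourier R; exact: h. Qed.

Lemma normsq_fourier u : normsq (F u) = normsq u.
Proof. by rewrite !normsqE fourier_inner. Qed.

Lemma square_integrableZ a (f : R -> R[i]) : square_integrable f ->
  square_integrable (fun t => a * f t).
Proof.
move=> sf; have : a *: f \in @L2pred R by apply: rpredZ; exact/asboolP.
by move/asboolP.
Qed.

Lemma toL2Z a (f : R -> R[i]) : square_integrable f ->
  toL2 (fun t => a * f t) = a *: toL2 f.
Proof.
move=> sf; apply: eq_ae_repr.
have := repr_toL2_ae (square_integrableZ a sf).
apply: (@filterS3 _ _ (ae_filter_ringOfSetsType lebesgue_measure) _ _ _ _ _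
  (repr_toL2_ae sf) (reprZ_ae a (toL2 f))) => t.
by move=> <- -> ->.
Qed.

Lemma fourier_hvec n : F (hvec n) = i ^+ n *: hvec n.
Proof.
have [_ h] := @fourier_is_fourier R.
rewrite h; last exact: schwartz_hermite_fun.
by rewrite fourier_integral_hermite toL2Z//; exact: square_integrable_hermite.
Qed.

(** Unitarity, applied to the pair u, h_n, brings in the conjugate of i^n, which is its inverse. *)
Lemma inner_fourier u n : inner (F u) (hvec n) = i ^+ n * inner u (hvec n).
Proof. by rewrite -(fourier_inner u) fourier_hvec innerZr mulrA iX_conj mul1r. Qed.

Lemma normsq_neq0 u : 0 < normsq u -> u != 0.
Proof. by apply: contraTneq => ->; rewrite normsq0 ltxx. Qed.

Lemma L2norm_lt u (eps : R) : 0 < eps -> normsq u <= (eps / 2) ^+ 2 -> L2norm u < eps.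
Proof.
move=> e0 ue; have e2 : 0 <= eps / 2 by lra.
rewrite L2normE; apply: (@le_lt_trans _ _ (eps / 2)); last by lra.
by rewrite -[leRHS](ger0_norm e2) -sqrtr_sqr ler_wsqrtr.
Qed.

Section Eigenspaces.
Variable j : nat.
Hypothesis j4 : (j < 4)%N.

Lemma iX_mul4 k : i ^+ (4 * k + j) = i ^+ j.
Proof. by rewrite exprD mulnC exprM iX4 mul1r. Qed.

Lemma eigspace_hvec k : eigspace F (i ^+ j) (hvec (4 * k + j)).
Proof. by rewrite /eigspace/= fourier_hvec iX_mul4. Qed.

Lemma eigspace_inner_eq0 u n : eigspace F (i ^+ j) u -> i ^+ n != i ^+ j ->
  inner u (hvec n) = 0.
Proof.
move=> uj nj; have := inner_fourier u n; rewrite uj innerZl => /eqP.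
rewrite -subr_eq0 -mulrBl mulf_eq0 subr_eq0 eq_sym (negPf nj)/=.
by move/eqP.
Qed.

Lemma iX_inj m n : (m < 4)%N -> (n < 4)%N -> i ^+ m = i ^+ n -> m = n.
Proof.
have n1 : (-1 : R) <> 1 by lra.
have z1 : (0 : R) <> 1 by lra.
have z2 : (0 : R) <> -1 by lra.
have i1 : i ^+ 1 = i by rewrite expr1.
have i3 : i ^+ 3 = - i by rewrite exprS sqr_i mulrN1.
move: m n => [|[|[|[|m]]]] [|[|[|[|n]]]] // _ _;
  rewrite ?expr0 ?i1 ?sqr_i ?i3 => h; exfalso;
  move: (congr1 (@complex.Re R) h) (congr1 (@complex.Im R) h) => /=; lra.
Qed.

Lemma sum_mod4 (a : nat -> R) n :
  (forall k r, (r < 4)%N -> r != j -> a (4 * k + r)%N = 0) ->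
  \sum_(k < 4 * n) a k = \sum_(k < n) a (4 * k + j)%N.
Proof.
move=> a0; elim: n => [|n IH]; first by rewrite muln0 !big_ord0.
have -> : (4 * n.+1 = (4 * n).+4)%N by rewrite mulnS addnC addn4.
rewrite !big_ord_recr/= IH -!addrA; congr (_ + _).
move: {a0 IH} (a0 n); move: (4 * n)%N => m am.
have a0 : 0%N != j -> a m = 0 by rewrite -(addn0 m); exact: am.
have a1 : 1%N != j -> a m.+1 = 0 by rewrite -(addn1 m); exact: am.
have a2 : 2%N != j -> a m.+2 = 0 by rewrite -(addn2 m); exact: am.
have a3 : 3%N != j -> a m.+3 = 0 by rewrite -(addn3 m); exact: am.
move: j4 a0 a1 a2 a3; case: (j) => [|[|[|[|//]]]] _ a0 a1 a2 a3.
- by rewrite a1// a2// a3// !addr0 addn0.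
- by rewrite a0// a2// a3// !addr0 add0r addn1.
- by rewrite a0// a1// a3// !addr0 !add0r addn2.
- by rewrite a0// a1// a2// !add0r addn3.
Qed.

(** An eigenvector has no Hermite coefficients outside the residue class j modulo 4, so Parseval for
    the whole system restricts to the subsystem. *)
Lemma energy_eigspace u n : eigspace F (i ^+ j) u ->
  energy hvec (coef hvec u) (4 * n) =
  energy (fun k => hvec (4 * k + j)) (coef (fun k => hvec (4 * k + j)) u) n.
Proof.
move=> uj; have c0 k r : (r < 4)%N -> r != j ->
    cmod2 (coef hvec u (4 * k + r)) * normsq (hvec (4 * k + r) : L2 R) = 0.
  move=> r4 rj; rewrite /coef eigspace_inner_eq0 ?mulr0//.
    by rewrite /cmod2/= expr0n addr0 mul0r.
  rewrite exprD mulnC exprM iX4 mul1r; apply: contra rj => /eqP h.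
  exact/eqP/iX_inj.
rewrite /energy (@sum_mod4 (fun k => cmod2 (coef hvec u k) * normsq (hvec k : L2 R)) n c0).
by apply: eq_bigr => k _; rewrite /coef.
Qed.

Lemma orthogonal_basis_eigspace :
  orthogonal_basis (eigspace F (i ^+ j)) (fun k => hvec (4 * k + j)).
Proof.
have orth m n : m != n -> inner (hvec (4 * m + j)) (hvec (4 * n + j)) = 0 :> R[i].
  by move=> mn; rewrite inner_hvec_neq// eqn_add2r eqn_mul2l.
split=> [n|//|u uj eps eps0].
  by split; [exact: eigspace_hvec|exact/normsq_neq0/normsq_hvec_gt0].
have eps2 : 0 < (eps / 2) ^+ 2 by rewrite exprn_gt0 ?divr_gt0.
have [N NP] := parseval inner_hvec_neq normsq_hvec_gt0 L2_hermite_complete u eps2.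
exists N, (coef (fun k => hvec (4 * k + j)) u); apply: L2norm_lt => //.
rewrite (@normsqB_partial_sum _ _ orth); last first.
  by move=> k _; apply: coefP => n; exact: normsq_hvec_gt0.
(* N terms of the subsystem correspond to 4 N terms of the full system, beyond the index N given by
   Parseval. *)
by rewrite -energy_eigspace//; apply: NP; rewrite leq_pmull.
Qed.

End Eigenspaces.

(** If n vectors spanned X, the coordinates of n + 1 members of the basis would form a matrix with a
    nonzero left kernel, a linear relation that orthogonality excludes. *)
Lemma orthogonal_basis_infinite (X : set (L2 R)) (e : nat -> L2 R) :
  orthogonal_basis X e -> ~ finite_dimensional X.
Proof.
move=> [eX orth _] [n [v XE]].
have hc (k : 'I_n.+1) : exists c : 'I_n -> R[i], e k = \sum_i c i *: v i.
  by have := (eX k).1; rewrite XE.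
pose C : 'M[R[i]]_(n.+1, n) := \matrix_(k, l) sval (cid (hc k)) l.
have CE k : e (k : 'I_n.+1) = \sum_l C k l *: v l.
  by rewrite (svalP (cid (hc k))); apply: eq_bigr => l _; rewrite mxE.
have : kermx C != 0.
  rewrite kermx_eq0 /row_free; apply/eqP => h.
  by have := rank_leq_col C; rewrite h ltnn.
move=> /rowV0Pn[d /sub_kermxP dC /eqP d0]; apply: d0.
have sum0 : \sum_(k < n.+1) d 0 k *: e k = 0.
  under eq_bigr do rewrite CE scaler_sumr.
  rewrite exchange_big/= big1// => l _.
  under eq_bigr do rewrite scalerA.
  rewrite -scaler_suml; have : (d *m C) 0 l = 0 by rewrite dC mxE.
  by rewrite mxE => ->; rewrite scale0r.
apply/rowP => k; rewrite mxE.
have := congr1 (fun w => inner w (e k)) sum0.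
rewrite inner_suml inner0l (bigD1 k)//= big1 ?addr0 => [|l lk]; last first.
  by rewrite innerZl orth ?mulr0.
rewrite innerZl => /eqP; rewrite mulf_eq0 => /orP[/eqP //|/eqP ek0].
have /negP[] := (eX k).2; apply/eqP/normsq_eq0.
by rewrite normsqE ek0.
Qed.

Lemma fourier_eigenvector j : (j < 4)%N ->
  hvec j != 0 :> L2 R /\ eigspace F (i ^+ j) (hvec j).
Proof.
by move=> j4; split; [exact/normsq_neq0/normsq_hvec_gt0|rewrite /eigspace/= fourier_hvec].
Qed.

(** The average of the lambda^(-k) F^k for k < 4, written with lambda^(-k) = lambda^(4-k) since
    lambda^4 = 1. *)
Definition eigproj lambda u : L2 R :=
  4^-1 *: (u + lambda ^+ 3 *: F u + lambda ^+ 2 *: F (F u) + lambda *: F (F (F u))).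

Lemma inner_eigproj lambda u n (z := i ^+ n) : inner (eigproj lambda u) (hvec n) =
  4^-1 * (1 + lambda ^+ 3 * z + lambda ^+ 2 * z ^+ 2 + lambda * z ^+ 3) *
  inner u (hvec n).
Proof. by rewrite innerZl !innerDl !innerZl !inner_fourier -/z; ring. Qed.

Lemma eigspace_eigproj lambda u : lambda ^+ 4 = 1 ->
  eigspace F lambda (eigproj lambda u).
Proof.
move=> l4; apply: L2_hermite_inj => n; rewrite innerZl inner_fourier inner_eigproj.
have := iX4 n; set z := i ^+ n => z4; set c := inner _ _; rewrite !mulrA.
congr (_ * _); rewrite ![_ * 4^-1]mulrC -!mulrA; congr (_ * _).
apply/eqP; rewrite -subr_eq0.
(* The geometric sum telescopes after multiplication by z - lambda. *)
rewrite [X in X == 0](_ : _ = lambda * (z ^+ 4 - 1) - z * (lambda ^+ 4 - 1)); last by ring.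
by rewrite z4 l4 !subrr !mulr0 subrr.
Qed.

(** Unitarity multiplies the inner product by lambda1 times the conjugate of lambda2, which is 1
    only if lambda1 = lambda2. *)
Lemma eigspace_orth lambda1 lambda2 u v : cmod2 lambda2 = 1 -> lambda1 != lambda2 ->
  eigspace F lambda1 u -> eigspace F lambda2 v -> inner u v = 0.
Proof.
move=> l1 l12 ul vl; have := fourier_inner u v; rewrite ul vl innerZl innerZr mulrA.
move/eqP; rewrite -subr_eq0 -[X in _ - X]mul1r -mulrBl mulf_eq0.
move=> /orP[|/eqP //]; rewrite subr_eq0 => /eqP h; case/negP: l12; apply/eqP.
rewrite -[RHS]mul1r -h -mulrA [X in _ * X](_ : _ = 1) ?mulr1//.
move: l1; case: (lambda2) => a b; rewrite /cmod2/= => ab.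
by apply/eqP; rewrite eq_complex/=; apply/andP; split; apply/eqP; [rewrite -ab|]; ring.
Qed.

Definition unit_roots : 4.-tuple R[i] := [tuple 1; -1; i; -i].

(** The points are listed as 1, -1, i, -i rather than as successive powers of i, hence the permuted
    exponents. *)
Definition unit_root_exp (k : 'I_4) : nat := nth 0%N [:: 0; 2; 1; 3]%N k.

Lemma unit_root_exp_lt k : (unit_root_exp k < 4)%N.
Proof. by case: k => [[|[|[|[|]]]]]. Qed.

Lemma unit_root_exp_inj : injective unit_root_exp.
Proof.
by move=> [[|[|[|[|m]]]] hm] [[|[|[|[|n]]]] hn] // _; apply: val_inj.
Qed.

Lemma i_pow3 : i ^+ 3 = - i. Proof. by rewrite exprS sqr_i mulrN1. Qed.

Lemma tnth_unit_roots k : tnth unit_roots k = i ^+ unit_root_exp k.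
Proof.
case: k => [[|[|[|[|m]]]] hk] //; rewrite (tnth_nth 0) /unit_root_exp/=.
- by rewrite sqr_i.
- by rewrite i_pow3.
Qed.

Lemma unit_rootsP lambda : lambda \in unit_roots -> exists k, lambda = tnth unit_roots k.
Proof. by move=> /tnthP. Qed.

Lemma unit_roots_inj k l : k != l -> tnth unit_roots k != tnth unit_roots l.
Proof.
move=> kl; rewrite !tnth_unit_roots; apply: contra kl => /eqP h.
by apply/eqP/unit_root_exp_inj; apply: iX_inj h; exact: unit_root_exp_lt.
Qed.

Lemma unit_root4 k : tnth unit_roots k ^+ 4 = 1.
Proof. by rewrite tnth_unit_roots iX4. Qed.

Lemma sum_eigproj u : \sum_(k < 4) eigproj (tnth unit_roots k) u = u.
Proof.
apply: L2_hermite_inj => n; rewrite inner_suml.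
under eq_bigr do rewrite inner_eigproj.
rewrite !big_ord_recl big_ord0 !(tnth_nth 0)/=.
set z := i ^+ n; set c := inner _ _.
(* Over the four points, lambda and lambda^3 cancel in opposite pairs, while lambda^2 sums to 2 (1 +
   i^2). *)
rewrite [LHS](_ : _ = c + (1 + i ^+ 2) * (2^-1 * z ^+ 2 * c)); last by field.
by rewrite sqr_i subrr mul0r addr0.
Qed.

Lemma fourier_orthogonal_sum :
  orthogonal_sum (fun k : 'I_4 => eigspace F (tnth unit_roots k)).
Proof.
have l1 k : cmod2 (tnth unit_roots k) = 1 by rewrite tnth_unit_roots cmod2_iX.
have orth k l u v : k != l -> eigspace F (tnth unit_roots k) u ->
    eigspace F (tnth unit_roots l) v -> inner u v = 0.
  by move=> kl; apply: eigspace_orth (l1 l) _; exact: unit_roots_inj.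
split=> [k l kl u v|u]; first exact: orth.
exists (fun k => eigproj (tnth unit_roots k) u); split.
  split; last by rewrite sum_eigproj.
  by move=> k; apply: eigspace_eigproj; exact: unit_root4.
move=> v [vX uv]; apply/funext => k.
set p := eigproj _.
have FB x y : F (x - y) = F x - F y.
  by have := fourier_linear (-1) y x; rewrite !scaleN1r ![- _ + _]addrC.
have dX l : eigspace F (tnth unit_roots l) (eigproj (tnth unit_roots l) u - v l).
  rewrite /eigspace/= FB scalerBr; congr (_ - _); last exact: vX.
  by apply: eigspace_eigproj; exact: unit_root4.
apply/eqP; rewrite -subr_eq0; apply/eqP/normsq_eq0.
(* The differences of the two decompositions lie in orthogonal eigenspaces and sum to 0. Pairing the
   sum with the k-th difference isolates its squared norm. *)
have : inner (\sum_l (eigproj (tnth unit_roots l) u - v l))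
    (eigproj (tnth unit_roots k) u - v k) = 0.
  by rewrite sumrB sum_eigproj -uv subrr inner0l.
rewrite inner_suml (bigD1 k)//= big1 ?addr0 => [|l lk]; last exact: orth (dX l) (dX k).
by rewrite normsqE => ->.
Qed.

(** From (F - lambda)(F^3 + lambda F^2 + lambda^2 F + lambda^3) = F^4 - lambda^4 = 1 - lambda^4. *)
Definition fourier_resolvent lambda u : L2 R := (1 - lambda ^+ 4)^-1 *:
  ((F (F (F u)) + lambda *: F (F u)) + (lambda ^+ 2 *: F u + lambda ^+ 3 *: u)).

Lemma inner_resolvent lambda u n (z := i ^+ n) :
  inner (fourier_resolvent lambda u) (hvec n) = (1 - lambda ^+ 4)^-1 *
    (z ^+ 3 + lambda * z ^+ 2 + lambda ^+ 2 * z + lambda ^+ 3) * inner u (hvec n).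
Proof. by rewrite innerZl !innerDl !innerZl !inner_fourier -/z; ring. Qed.

Lemma bounded_resolvent lambda : bounded_op (fourier_resolvent lambda).
Proof.
set l := lambda.
(* Two applications of [normsqD_le] to the four terms give the factors 4, F being an isometry. *)
pose M := cmod2 (1 - l ^+ 4)^-1 *
  (4 + 4 * cmod2 l + 4 * cmod2 (l ^+ 2) + 4 * cmod2 (l ^+ 3)).
have M0 : 0 <= M by rewrite mulr_ge0 ?cmod2_ge0// !addr_ge0// mulr_ge0 ?cmod2_ge0.
exists (Num.sqrt M) => u; rewrite !L2normE -sqrtrM// ler_wsqrtr//.
rewrite normsqZ -mulrA ler_wpM2l ?cmod2_ge0//.
apply: le_trans (normsqD_le _ _) _.
have h1 := normsqD_le (F (F (F u))) (l *: F (F u)).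
have h2 := normsqD_le (l ^+ 2 *: F u) (l ^+ 3 *: u).
move: h1 h2; rewrite !normsqZ !normsq_fourier; nra.
Qed.

Lemma linear_op0 (S : L2 R -> L2 R) : linear S -> S 0 = 0.
Proof. by move=> linS; have := linS (-1) 0 0; rewrite !scaleN1r !addNr. Qed.

Lemma unit_roots_mem lambda : lambda ^+ 4 = 1 -> lambda \in unit_roots.
Proof.
move=> l4; have : (lambda - 1) * (lambda + 1) * ((lambda - i) * (lambda + i)) = 0.
  rewrite [LHS](_ : _ = (lambda ^+ 2 - 1) * (lambda ^+ 2 - i ^+ 2)); last by ring.
  by rewrite sqr_i; transitivity (lambda ^+ 4 - 1); [ring|rewrite l4 subrr].
move=> /eqP; rewrite !mulf_eq0 !subr_eq0 !addr_eq0 !inE.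
by move=> /orP[/orP[]|/orP[]] ->; rewrite ?orbT.
Qed.

Lemma fourier_spectrum : spectrum F = [set lambda | lambda \in unit_roots].
Proof.
apply/seteqP; split=> [lambda|lambda /unit_rootsP[k ->] [S [linS _ SF _]]] /=.
  move=> sp; apply: contrapT => /negP lr.
  have l4 : 1 - lambda ^+ 4 != 0.
    by apply: contra lr; rewrite subr_eq0 eq_sym => /eqP /unit_roots_mem.
  have key u n : inner (fourier_resolvent lambda u) (hvec n) * (i ^+ n - lambda) =
      inner u (hvec n).
    rewrite inner_resolvent; have := iX4 n; set z := i ^+ n => z4.
    set c := inner _ _.
    rewrite [LHS](_ : _ = (1 - lambda ^+ 4)^-1 * (z ^+ 4 - lambda ^+ 4) * c); last by ring.
    by rewrite z4 mulVf// mul1r.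
  apply: sp; exists (fourier_resolvent lambda); split.
  - move=> a u v; apply: L2_hermite_inj => n.
    by rewrite inner_resolvent !innerDl !(innerZl a) !inner_resolvent; ring.
  - exact: bounded_resolvent.
  - move=> u; apply: L2_hermite_inj => n; rewrite -(key u).
    by rewrite !inner_resolvent innerBl innerZl inner_fourier; ring.
  - move=> u; apply: L2_hermite_inj => n; rewrite -(key u).
    by rewrite innerBl (innerZl lambda) inner_fourier; ring.
(* F - lambda sends the eigenvector to 0, so a linear left inverse would make that vector 0. *)
have kl := unit_root_exp_lt k.
have [h0 hX] := fourier_eigenvector kl; move/negP: h0; apply; apply/eqP.
rewrite -[LHS]SF tnth_unit_roots [F _]hX subrr; exact: linear_op0.
Qed.

Lemma eigspace_unit_root_basis k : orthogonal_basis (eigspace F (tnth unit_roots k))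
  (fun n => hvec (4 * n + unit_root_exp k)).
Proof.
by rewrite tnth_unit_roots; exact/orthogonal_basis_eigspace/unit_root_exp_lt.
Qed.

End FourierSpectrum.

Theorem theorem3p1 (R : realType) :
  let i : R[i] := 0 +i* 1 in
  let F : L2 R -> L2 R := @fourier R in
  let X : R[i] -> set (L2 R) := eigspace F in
  let h (n : nat) : L2 R := toL2 (hermite_fun n) in
  let points : 4.-tuple R[i] := [tuple 1; -1; i; -i] in
  [/\ spectrum F = [set 1; -1; i; -i] /\
      (forall mu, mu \in points ->
         is_eigenvalue F mu /\ ~ finite_dimensional (X mu)),
      orthogonal_sum (fun j : 'I_4 => X (tnth points j)) /\
      (forall lambda, lambda \in points -> ~ finite_dimensional (X lambda)) &
      [/\ orthogonal_basis (X 1) (fun k => h (4 * k)%N),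
          orthogonal_basis (X i) (fun k => h (4 * k + 1)%N),
          orthogonal_basis (X (-1)) (fun k => h (4 * k + 2)%N) &
          orthogonal_basis (X (-i)) (fun k => h (4 * k + 3)%N)]].
Proof.
move=> i F X h points.
have infX mu : mu \in points -> ~ finite_dimensional (X mu).
  move=> /unit_rootsP[k ->].
  exact: orthogonal_basis_infinite (eigspace_unit_root_basis k).
split; first split.
- rewrite /F fourier_spectrum; apply/seteqP; split=> mu /=; rewrite !inE.
    by case/or4P => /eqP ->; [left; left; left|left; left; right|left; right|right].
  by move=> [[[->|->]|->]|->]; rewrite eqxx ?orbT.
- move=> mu mup; split; last exact: infX.
  move: mup => /unit_rootsP[k ->]; exists (hvec (unit_root_exp k)).
    by have [] := fourier_eigenvector (R := R) (unit_root_exp_lt k).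
  rewrite [tnth _ _]tnth_unit_roots.
  by have [] := fourier_eigenvector (R := R) (unit_root_exp_lt k).
- by split; [exact: fourier_orthogonal_sum|exact: infX].
- have b j : (j < 4)%N -> orthogonal_basis (X (i ^+ j)) (fun k => h (4 * k + j)%N).
    exact: orthogonal_basis_eigspace.
  split.
  + have := b 0%N isT; rewrite expr0; congr orthogonal_basis.
    by apply/funext => k; rewrite addn0.
  + by have := b 1%N isT; rewrite expr1.
  + by have := b 2%N isT; rewrite sqr_i.
  + by have := b 3%N isT; rewrite i_pow3.
Qed.
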